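(* Let $n\geq 2$ and let $\mathbb{P}=\mathbb{P}_n$ be the complex projective space with homogeneous coordinates $(x_0:\dots:x_n)$. Let $\mathcal{A}$ be the set of smooth arcs in $\mathbb{P}$, $\mathcal{A}^{o}\subset\mathcal{A}$ the subset of non-inflexional arcs, and $\mathcal{M}\subset\mathcal{A}^o$ the Monge hypersurface. Let $\mu_3\subset PSL_2(\mathbb{C})$ be the subgroup of order $3$ generated by the class of $\begin{pmatrix}e^{i\pi/3}&0\\0&e^{-i\pi/3}\end{pmatrix}$, acting on $\mathbb{P}$ (hence on $\mathcal{A}$) through the $n$-th symmetric power representation of $SL_2(\mathbb{C})$ on $\mathbb{C}^{n+1}$. Let $\mathcal{S}_{\mu_3}\subset\mathcal{A}$ be the set of arcs which can be represented in the form $$(1,\;t,\;t^{2}+O(t^{n+3}),\ldots,t^{n-2}+O(t^{n+3}),\;t^{n-1}+O(t^{n+4}),\;t^{n}+t^{n+3}+O(t^{n+4}))$$ if $n\geq 3$, and in the form $$(1,\;t,\;t^{2}+t^{5}+O(t^{7}))$$ if $n=2$. Then each $SL_{n+1}(\mathbb{C})$-orbit in $\mathcal{A}^{o}\setminus\mathcal{M}$ meets $\mathcal{S}_{\mu_{3}}$ along a $\mu_3$-orbit (that is, the intersection is exactly one $\mu_3$-orbit). In particular $(\mathcal{S}_{\mu_3},\mu_3)$ is a slice for the action of $SL_{n+1}(\mathbb{C})$ on $\mathcal{A}$.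
   Context: Smooth arcs. A parametrised smooth arc in $\mathbb{P}=\mathbb{P}_n$ is a formal series $a=\sum_{i\geq 0}a_it^i\in\mathbb{C}^{n+1}\otimes\mathbb{C}[[t]]$ (i.e. an $(n+1)$-tuple of power series) with $a_0\wedge a_1\neq 0$. A smooth arc $(\mathcal{C},O)$, $O=[a_0]$, is a parametrised smooth arc modulo multiplication by power series with non-zero constant term and modulo substitution $t\mapsto u(t)$ with $u$ a power series of order exactly $1$. $SL_{n+1}(\mathbb{C})$ acts on arcs through its linear action on $\mathbb{C}^{n+1}$; this action factors through $PGL_{n+1}(\mathbb{C})$. The arc is non-inflexional if $\det(a_0,\ldots,a_n)\neq 0$. $O(t^i)$ denotes an arbitrary power series of order $\geq i$. In every arc of the form $(1,t,f_2(t),\ldots,f_n(t))$ with $f_i(0)=0$ the parameter is the affine coordinate $x_1/x_0$, so the series $f_i$ are uniquely determined by the arc. Representation of $SL_2$. With $\nu(x,y)=(x^n,x^{n-1}y,\ldots,y^n)$, $SL_2(\mathbb{C})$ acts on $\mathbb{C}^{n+1}$ by the unique linear representation $\rho$ satisfying $\rho(g)\nu(x,y)=\nu(g(x,y))$; it induces an action of $PSL_2(\mathbb{C})$ on $\mathbb{P}_n$ preserving the standard normal rational curve $t\mapsto(1:t:\cdots:t^n)$. Monge hypersurface. For a non-inflexional arc $(\mathcal{C},O)$ there is a unique normal rational curve $\Gamma$ of degree $n$ in $\mathbb{P}$ containing the subscheme of length $n+3$ of $\mathcal{C}$ supported at $O$ (the image of $\mathrm{Spec}\,\mathbb{C}[[t]]/(t^{n+3})$).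 Choose linear coordinates in which $\Gamma$ is $t\mapsto(1:t:\cdots:t^n)$ and $O=(1:0:\cdots:0)$; then $(\mathcal{C},O)$ is represented by $(1,\,t,\,t^2+c_2t^{n+3}+O(t^{n+4}),\ldots,t^n+c_nt^{n+3}+O(t^{n+4}))$. The condition $c_n=0$ does not depend on the choices; it expresses that the Zariski tangent plane at $O$ of $\mathcal{C}\cup\Gamma$ (a hyperplane with equation $l$ being said to contain this plane iff $l(a(t)-(1,t,\ldots,t^n))=O(t^{n+4})$) is contained in the common osculating hyperplane of $\mathcal{C}$ and $\Gamma$ at $O$. The Monge hypersurface $\mathcal{M}\subset\mathcal{A}^o$ is the set of non-inflexional arcs with $c_n=0$. Slice. If a group $G$ acts on a variety $X$, $Y\subset X$ is locally closed and $H$ is a subgroup of $G$ (or of the group through which $G$ acts) stabilising $Y$, the couple $(Y,H)$ is a slice for the action of $G$ on $X$ if a general $G$-orbit in $X$ meets $Y$ along an $H$-orbit. Here $\mathcal{A}$ is the projective limit over $r$ of the finite-dimensional varieties of arcs truncated modulo $t^{r+1}$, and ''general'' means in a non-empty Zariski-open subset. *)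

(* Defs.v *)
(* The theorem is stated for [F = R[i]], [R : realType]: complex numbers. *)
From mathcomp Require Import all_boot all_order all_algebra.
From mathcomp Require Import complex boolp classical_sets reals trigo.
From mathcomp Require Import mpoly.
Set Implicit Arguments. Unset Strict Implicit. Unset Printing Implicit Defensive.
Import Order.TTheory GRing.Theory Num.Theory.
Local Open Scope ring_scope.
Local Open Scope classical_set_scope.

(** * Smooth arcs *)

(* A formal power series over [F] is its sequence of coefficients; an element
   of F^(n+1) (x) F[[t]] is the sequence [a_0, a_1, ...] of its vector
   coefficients. *)
Definition series (F : fieldType) := nat -> F.
Definition vseries (F : fieldType) (n : nat) := nat -> 'cV[F]_n.+1.

Definition coord (F : fieldType) (n : nat) (a : vseries F n) (i : nat)
  : series F := fun k => a k (inord i) 0.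

Definition eq_series (F : fieldType) (s : series F) (p : {poly F}) :=
  forall k, s k = p`_k.

(* [s = p + O(t^m)], the polynomial [p] being read in the variable [t] *)
Definition eq_series_upto (F : fieldType) (m : nat) (s : series F)
  (p : {poly F}) := forall k, (k < m)%N -> s k = p`_k.

(* Nonvanishing of [a_0 /\ a_1], whose coordinates are the 2x2 minors. *)
Definition smooth_param (F : fieldType) (n : nat) (a : vseries F n) :=
  exists i j, a 0%N i 0 * a 1%N j 0 - a 0%N j 0 * a 1%N i 0 != 0.

Definition series_mul (F : fieldType) (n : nat) (w : series F)
  (a : vseries F n) : vseries F n :=
  fun k => \sum_(i < k.+1) w i *: a (k - i)%N.

(* [a(u(t))] for [u] without constant term: then the coefficient of [t^k] in
   [u^i] only depends on [u] modulo [t^(k+1)], and vanishes for [i > k]. *)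
Definition series_subst (F : fieldType) (n : nat) (a : vseries F n)
  (u : series F) : vseries F n :=
  fun k => \sum_(i < k.+1) ((\poly_(j < k.+1) u j) ^+ i)`_k *: a i.

(* The smooth arc represented by [a] is the class of [a] modulo multiplication
   by units and substitutions of order 1: a set of parametrised arcs. *)
Definition arc (F : fieldType) (n : nat) (a : vseries F n)
  : set (vseries F n) :=
  [set b | exists w u : series F,
     [/\ w 0%N != 0, u 0%N = 0, u 1%N != 0 &
         b = series_mul w (series_subst a u)]].

Definition smooth_arcs (F : fieldType) (n : nat) : set (set (vseries F n)) :=
  [set arc a | a in [set a | smooth_param a]].

Definition noninflexional_arcs (F : fieldType) (n : nat)
  : set (set (vseries F n)) :=
  [set arc a | a in [set a | smooth_param a /\
     \det (\matrix_(i < n.+1, j < n.+1) a j i 0) != 0]].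

(** * Group actions on arcs *)

Definition act (F : fieldType) (n : nat) (g : 'M[F]_n.+1)
  (X : set (vseries F n)) : set (vseries F n) :=
  [set (fun k => g *m a k) | a in X].

Definition SL_orbit (F : fieldType) (n : nat) (X : set (vseries F n))
  : set (set (vseries F n)) :=
  [set act g X | g in [set g : 'M[F]_n.+1 | \det g = 1]].

(* Elements of PGL_{n+1} are classes of invertible matrices modulo nonzero
   scalars, with the induced product and action on arcs. *)
Definition pgl (F : fieldType) (n : nat) (g : 'M[F]_n.+1)
  : set 'M[F]_n.+1 := [set c *: g | c in [set c : F | c != 0]].

Definition pgl_mul (F : fieldType) (n : nat) (K L : set 'M[F]_n.+1)
  : set 'M[F]_n.+1 := [set g *m h | g in K & h in L].

Definition pgl_act (F : fieldType) (n : nat) (K : set 'M[F]_n.+1)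
  (X : set (vseries F n)) : set (vseries F n) :=
  \bigcup_(g in K) act g X.

Definition pgl_subgroup (F : fieldType) (n : nat)
  (H : set (set 'M[F]_n.+1)) :=
  [/\ H `<=` [set pgl g | g in [set g : 'M[F]_n.+1 | g \in unitmx]],
      H (pgl 1%:M),
      (forall K L, H K -> H L -> H (pgl_mul K L)) &
      (forall g : 'M[F]_n.+1, g \in unitmx -> H (pgl g) -> H (pgl (invmx g)))].

Definition pgl_orbit (F : fieldType) (n : nat) (H : set (set 'M[F]_n.+1))
  (X : set (vseries F n)) : set (set (vseries F n)) :=
  [set pgl_act K X | K in H].

(* the SL_{n+1}-orbit of [X] meets [Y] along an [H]-orbit *)
Definition meets_along_orbit (F : fieldType) (n : nat)
  (X : set (vseries F n)) (Y : set (set (vseries F n)))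
  (H : set (set 'M[F]_n.+1)) :=
  exists2 Z, Y Z & SL_orbit X `&` Y = pgl_orbit H Z.

(** * The n-th symmetric power of the standard representation of SL_2 *)

Definition veronese (F : fieldType) (n : nat) (x y : F) : 'cV[F]_n.+1 :=
  \col_(i < n.+1) (x ^+ (n - i) * y ^+ i).

(* The (i, j) entry is the coefficient of [x^(n-j) y^j] in
   [(g_00 x + g_01 y)^(n-i) (g_10 x + g_11 y)^i]. Over an infinite field, where
   the vectors [veronese n x y] span, [sympow_veronese] below characterises
   this matrix. *)
Definition sympow (F : fieldType) (n : nat) (g : 'M[F]_2) : 'M[F]_n.+1 :=
  \matrix_(i < n.+1, j < n.+1)
    (((g 0 0)%:P + (g 0 1)%:P * 'X) ^+ (n - i) *
     ((g 1 0)%:P + (g 1 1)%:P * 'X) ^+ i)`_j.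

Lemma dehomogenize_mul (F : fieldType) (a b x y : F) (m : nat)
    (P : {poly F}) : (size P <= m.+1)%N ->
  \sum_(j < m.+2) ((a%:P + b%:P * 'X) * P)`_j * (x ^+ (m.+1 - j) * y ^+ j) =
  (a * x + b * y) * \sum_(j < m.+1) P`_j * (x ^+ (m - j) * y ^+ j).
Proof.
move=> sP.
under eq_bigr => j _ do rewrite mulrDl coefD coefCM -mulrA [('X * P)]mulrC
  coefCM coefMX mulrDl.
rewrite big_split /= mulrDl; congr (_ + _).
  rewrite big_ord_recr /= (nth_default 0 sP) mulr0 mul0r addr0 mulr_sumr.
  apply: eq_bigr => j _; rewrite subSn ?exprS -1?ltnS //.
  by rewrite -!mulrA; congr (_ * _); rewrite mulrCA.
rewrite big_ord_recl /= mulr0 mul0r add0r mulr_sumr.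
apply: eq_bigr => j _; rewrite /bump /= add1n subSS exprS -!mulrA; congr (_ * _).
by rewrite [RHS]mulrCA; congr (_ * _); rewrite mulrCA.
Qed.

Lemma sympow_veronese (F : fieldType) (n : nat) (g : 'M[F]_2) (x y : F) :
  sympow n g *m veronese n x y =
  veronese n (g 0 0 * x + g 0 1 * y) (g 1 0 * x + g 1 1 * y).
Proof.
pose L (a b : F) : {poly F} := a%:P + b%:P * 'X.
have sL a b : (size (L a b) <= 2)%N.
  rewrite (leq_trans (size_polyD _ _)) // geq_max.
  rewrite (leq_trans (size_polyC_leq1 _)) //=.
  by rewrite (leq_trans (size_polyMleq _ _)) // size_polyX addn2 /=
     ltnS size_polyC_leq1.
have step a b k m (P : {poly F}) : (size P <= m.+1)%N ->
  (size (L a b ^+ k * P)%R <= (k + m).+1)%N /\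
  \sum_(j < (k + m).+1) (L a b ^+ k * P)`_j * (x ^+ (k + m - j) * y ^+ j) =
  (a * x + b * y) ^+ k * \sum_(j < m.+1) P`_j * (x ^+ (m - j) * y ^+ j).
  move=> sP; elim: k => [|k [sk IH]]; first by rewrite !expr0 !mul1r add0n.
  rewrite !exprS -!mulrA addSn; split; last first.
    by rewrite dehomogenize_mul // IH.
  rewrite (leq_trans (size_polyMleq _ _)) //.
  by rewrite -subn1 leq_subLR (leq_trans (leq_add (sL a b) sk)).
apply/colP => i; rewrite !mxE.
have le_in : (i <= n)%N by rewrite -ltnS.
under eq_bigr => j _ do rewrite !mxE.
have s1 : (size (1%R : {poly F}) <= 1)%N by rewrite size_poly1.
have [sB EB] := step (g 1 0) (g 1 1) i 0%N 1 s1.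
have [_ ] := step (g 0 0) (g 0 1) (n - i)%N (i + 0)%N _ sB.
rewrite EB addn0 subnK // mulr1 => ->; congr (_ * _).
by rewrite big_ord1 coef1 /= !expr0 !mulr1.
Qed.

(** * The Monge hypersurface *)

(* Subvarieties of P_n are given by their cones, as sets of nonzero vectors. *)
Definition standard_nrc (F : fieldType) (n : nat) : set 'cV[F]_n.+1 :=
  [set v | exists c x y : F,
     [/\ c != 0, (x != 0) || (y != 0) & v = c *: veronese n x y]].

Definition normal_rational_curve (F : fieldType) (n : nat)
  (Gamma : set 'cV[F]_n.+1) :=
  exists2 g : 'M[F]_n.+1, g \in unitmx &
    Gamma = [set g *m v | v in @standard_nrc F n].

(* [Gamma] contains the image of Spec F[t]/(t^m) under the arc [X]: homogeneous
   polynomials vanishing on [Gamma] pull back to 0 modulo [t^m]. *)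
Definition contains_subscheme (F : fieldType) (n m : nat)
  (Gamma : set 'cV[F]_n.+1) (X : set (vseries F n)) :=
  forall (a : vseries F n) (d : nat) (p : {mpoly F[n.+1]}),
    X a ->
    p \is d.-homog ->
    (forall v, Gamma v -> p.@[fun i => v i 0] = 0) ->
    forall k, (k < m)%N ->
      (mmap (@polyC F) (fun i => \poly_(l < m) a l i 0) p)`_k = 0.

(* [g] is a change of linear coordinates bringing the osculating curve [Gamma]
   to the standard one; the representative [f] of the transformed arc is
   centred at (1:0:...:0). *)
Definition monge_hypersurface (F : fieldType) (n : nat)
  : set (set (vseries F n)) :=
  [set X | noninflexional_arcs X /\
     exists (Gamma : set 'cV[F]_n.+1) (g : 'M[F]_n.+1) (f : vseries F n)
            (c : nat -> F),
     [/\ normal_rational_curve Gamma /\ contains_subscheme (n + 3) Gamma X,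
         g \in unitmx /\ [set g *m v | v in Gamma] = @standard_nrc F n,
         act g X f,
         [/\ eq_series (coord f 0) 1,
             eq_series (coord f 1) 'X &
             forall i, (2 <= i <= n)%N ->
               eq_series_upto (n + 4) (coord f i)
                 ('X^i + c i *: 'X^(n + 3))] &
         c n = 0]].

(** * Zariski topology on the space of arcs *)

Definition zariski_closed (F : fieldType) (m p : nat)
  (W : set 'M[F]_(m, p)) :=
  exists E : set {mpoly F[m * p]},
    W = [set J | forall P, E P -> P.@[mxvec J 0] = 0].

(* [a] modulo [t^(r+1)]; column [k] holds the coefficient [a_k] *)
Definition jet (F : fieldType) (n r : nat) (a : vseries F n)
  : 'M[F]_(n.+1, r.+1) := \matrix_(i < n.+1, k < r.+1) a k i 0.

(* The points of the variety of arcs truncated modulo [t^(r+1)] are the sets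
   [jet r @` X] with [X] a smooth arc. This variety is the base of a locally
   trivial fibration with total space the parametrised jets, an open subset of
   an affine space; hence its Zariski topology is the quotient topology. *)
Definition open_truncated (F : fieldType) (n r : nat)
  (V : set (set 'M[F]_(n.+1, r.+1))) :=
  V `<=` [set jet r @` X | X in @smooth_arcs F n] /\
  zariski_closed (~` \bigcup_(J in V) J).

(* projective limit topology *)
Definition open_arcs (F : fieldType) (n : nat)
  (U : set (set (vseries F n))) :=
  U `<=` @smooth_arcs F n /\
  forall X, U X -> exists (r : nat) (V : set (set 'M[F]_(n.+1, r.+1))),
    [/\ open_truncated V, V (jet r @` X) &
        forall X', smooth_arcs X' -> V (jet r @` X') -> U X'].

Definition locally_closed_arcs (F : fieldType) (n : nat)
  (Y : set (set (vseries F n))) :=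
  exists U Z, [/\ open_arcs U, Z `<=` @smooth_arcs F n,
    open_arcs (@smooth_arcs F n `\` Z) & Y = U `&` Z].

(** * Slices *)

(* slices for the action of SL_{n+1} (which factors through PGL_{n+1}) on the
   space of smooth arcs *)
Definition slice (F : fieldType) (n : nat) (Y : set (set (vseries F n)))
  (H : set (set 'M[F]_n.+1)) :=
  [/\ locally_closed_arcs Y,
      pgl_subgroup H,
      (forall K X, H K -> Y X -> Y (pgl_act K X)) &
      exists U, [/\ open_arcs U, U !=set0 &
        forall X, U X -> meets_along_orbit X Y H]].

(** * The slice of the theorem *)

(* e^(i x) *)
Definition expi (R : realType) (x : R) : R[i] := (cos x +i* sin x)%C.

Definition mu3_gen (R : realType) : 'M[R[i]]_2 :=
  diag_mx (\row_(j < 2) if j == 0 then expi (pi / 3%:R)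
                        else expi (- (pi / 3%:R))).

(* the image in PGL_{n+1} of the subgroup of PSL_2 generated by the class of
   [mu3_gen] *)
Definition mu3 (R : realType) (n : nat) : set (set 'M[R[i]]_n.+1) :=
  [set pgl (sympow n (mu3_gen R ^+ k)) | k in [set: nat]].

Definition slice_form (F : fieldType) (n : nat) (f : vseries F n) :=
  [/\ eq_series (coord f 0) 1,
      eq_series (coord f 1) 'X &
      if (n == 2)%N then eq_series_upto 7 (coord f 2) ('X^2 + 'X^5)
      else [/\ forall i, (2 <= i <= n - 2)%N ->
                 eq_series_upto (n + 3) (coord f i) 'X^i,
               eq_series_upto (n + 4) (coord f (n - 1)) 'X^(n - 1) &
               eq_series_upto (n + 4) (coord f n) ('X^n + 'X^(n + 3))]].

Definition slice_mu3 (F : fieldType) (n : nat) : set (set (vseries F n)) :=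
  [set arc f | f in [set f : vseries F n | slice_form f]].

(* Main.v *)
(* Applying the inverse of the matrix [(a_0, ..., a_n)] to a non-inflexional arc
   [a], one may assume that its coordinates are [t^i P_i] with
   [P_i = 1] modulo [t^(n+1-i)]. Descending from [i = n - 2], one can add to each coordinate
   multiples of the following ones so that the new coordinates [t^i Q_i] satisfy
   [Q_i Q_(i+2) = Q_(i+1)^2] modulo [t^(n+1-i)]: they are in geometric progression
   modulo [t^(n+3)], and the arc acquires a representative [f] with [f_0 = 1],
   [f_1 = t] and [f_i = t^i + O(t^(n+3))].
   The same descent, with [Q_i] of degree at most [n - i], shows that such an [f] is
   unique up to the group of [t |-> z t / (x + y t)]. This group acts on
   the coefficient [c_n] of [t^(n+3)] in [f_n] and on the next one, [e] (that of
   [t^(n+3)] in [f_(n-1)], or of [t^6] in [f_2] if [n = 2]), by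
   [z^3 c_n' = x^3 c_n] and [z^4 e' = x^3 (x e + y c_n)]. If [c_n <> 0], there is
   thus a representative with [c_n = 1] and [e = 0], unique up to [z / x] in mu_3.
   The condition [c_n <> 0] is open because [c_n det (a_0, ..., a_n)^3] is a
   polynomial in the coefficients of [a]. *)
Require Import Defs.
From mathcomp Require Import all_boot all_order all_algebra.
From mathcomp Require Import complex boolp classical_sets reals trigo.
From mathcomp Require Import mpoly ring lra zify.
(* [path.arc] would otherwise shadow [Defs.arc]. *)
Import Defs.
Set Implicit Arguments. Unset Strict Implicit. Unset Printing Implicit Defensive.
Import Order.TTheory GRing.Theory Num.Theory.
Local Open Scope ring_scope.
Local Open Scope classical_set_scope.

(** * Power series and their truncations *)

Section Congruence.
Variable F : fieldType.
Implicit Types (p q r u v : {poly F}) (m k : nat).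

(** All computations are congruences between polynomials modulo t^m: a series enters through its
    truncations, and identities between series are recovered from all m. The obstacle is that the
    unit w and the substitution u relating two representatives are unknown. In the uniqueness
    argument they cancel from the quadratic relation between three consecutive coordinates. In the
    transformation laws, the forms x_i x_0^(i-1) - x_1^i, which vanish on the standard curve,
    isolate the terms of order n+3, so that only the leading coefficients of w and u matter; for n =
    2 one more order is required and is computed separately. The formula for c_n comes from the last
    quadratic relation, Q_(n-2) Q_n = Q_(n-1)^2: it is imposed modulo t^3, and the coefficient of
    t^3 of its defect is c_n. That the nonvanishing of this polynomial does not depend on the
    representative is deduced from the uniqueness of normal forms. Algebraic closedness supplies the
    cube root that normalises c_n and the (n+1)-th root that lifts PGL to SL. *)

Definition eqX m p q := forall k, (k < m)%N -> p`_k = q`_k.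

Lemma eqX_dvdp m p q : eqX m p q <-> 'X^m %| p - q.
Proof.
split=> [epq|/dvdpP[r e] k lt_km]; last first.
  by apply/eqP; rewrite -subr_eq0 -coefB e coefMXn lt_km.
rewrite -(poly_take_drop m (p - q)) (_ : take_poly m _ = 0).
  by rewrite add0r dvdp_mulIr.
apply/polyP=> k; rewrite coef_take_poly coef0; case: ifP => // lt_km.
by rewrite coefB epq ?subrr.
Qed.

Lemma eqX_refl m p : eqX m p p. Proof. by []. Qed.

Lemma eqX_sym m p q : eqX m p q -> eqX m q p.
Proof. by move=> e k /e. Qed.

Lemma eqX_trans m q p r : eqX m p q -> eqX m q r -> eqX m p r.
Proof. by move=> e f k lt_km; rewrite e ?f. Qed.

Lemma eqX_leq m' m p q : (m <= m')%N -> eqX m' p q -> eqX m p q.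
Proof. by move=> le_m e k lt_km; apply: e; apply: leq_trans le_m. Qed.

Lemma eqXD m p p' q q' : eqX m p p' -> eqX m q q' -> eqX m (p + q) (p' + q').
Proof. by move=> e f k lt_km; rewrite !coefD e ?f. Qed.

Lemma eqXN m p p' : eqX m p p' -> eqX m (- p) (- p').
Proof. by move=> e k lt_km; rewrite !coefN e. Qed.

Lemma eqXB m p p' q q' : eqX m p p' -> eqX m q q' -> eqX m (p - q) (p' - q').
Proof. by move=> e f; apply: eqXD => //; apply: eqXN. Qed.

Lemma eqXM m p p' q q' : eqX m p p' -> eqX m q q' -> eqX m (p * q) (p' * q').
Proof.
move=> e f k lt_km; rewrite !coefM; apply: eq_bigr => i _.
by rewrite e ?f //; apply: leq_ltn_trans lt_km; rewrite ?leq_subr -1?ltnS.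
Qed.

Lemma eqXZ m c p p' : eqX m p p' -> eqX m (c *: p) (c *: p').
Proof. by move=> e k lt_km; rewrite !coefZ e. Qed.

Lemma eqXX m k p p' : eqX m p p' -> eqX m (p ^+ k) (p' ^+ k).
Proof. by move=> e; elim: k => // k IH; rewrite !exprS; apply: eqXM. Qed.

Lemma eqX_sum m (I : Type) (s : seq I) (P : pred I) (f g : I -> {poly F}) :
  (forall i, P i -> eqX m (f i) (g i)) ->
  eqX m (\sum_(i <- s | P i) f i) (\sum_(i <- s | P i) g i).
Proof. by move=> e k lt_km; rewrite !coef_sum; apply: eq_bigr => i /e->. Qed.

Lemma eqX_prod m (I : Type) (s : seq I) (P : pred I) (f g : I -> {poly F}) :
  (forall i, P i -> eqX m (f i) (g i)) ->
  eqX m (\prod_(i <- s | P i) f i) (\prod_(i <- s | P i) g i).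
Proof.
move=> e; elim/big_rec2: _ => // i p q /e; exact: eqXM.
Qed.

Lemma eqX0_factor m p : eqX m p 0 -> exists r, p = 'X^m * r.
Proof. by move/eqX_dvdp; rewrite subr0 => /dvdpP[r ->]; exists r; rewrite mulrC. Qed.

Lemma eqX_mulXn j m p q : eqX (j + m) ('X^j * p) ('X^j * q) <-> eqX m p q.
Proof.
split=> [e k lt_km|e k lt_k].
  have:= e (j + k)%N; rewrite !coefXnM ltn_add2l => /(_ lt_km).
  by rewrite ltnNge leq_addr /= addKn.
by rewrite !coefXnM; case: ltnP => // le_jk; apply: e; lia.
Qed.

Lemma coef0_Xfactor u : u`_0 = 0 -> exists v, u = 'X * v.
Proof.
move=> u0; case: (@eqX0_factor 1 u) => [[]//|r ->]; first by rewrite coef0.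
by exists r; rewrite expr1.
Qed.

Lemma coef0M p q : (p * q)`_0 = p`_0 * q`_0.
Proof. by rewrite coefM big_ord1. Qed.

Lemma coef0X p k : (p ^+ k)`_0 = p`_0 ^+ k.
Proof. by rewrite -!horner_coef0 horner_exp. Qed.

Lemma comp_poly_exp p u k : (p ^+ k) \Po u = (p \Po u) ^+ k.
Proof.
by elim: k => [|k IH]; rewrite ?expr0 -?polyC1 ?comp_polyC // !exprS comp_polyM IH.
Qed.

Lemma coef0_comp p u : u`_0 = 0 -> (p \Po u)`_0 = p`_0.
Proof. by move=> u0; rewrite -[LHS]horner_coef0 horner_comp horner_coef0 u0 horner_coef0. Qed.

Lemma eqX_cancel m p q r : p`_0 != 0 -> eqX m (p * q) (p * r) -> eqX m q r.
Proof.
move=> p0 /eqX_dvdp; rewrite -mulrBr => dv; apply/eqX_dvdp.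
rewrite -(Gauss_dvdpr _ (_ : coprimep _ p)) //.
by apply: coprimep_expl; rewrite coprimep_sym coprimepX -?horner_coef0 /root horner_coef0.
Qed.

Lemma eqX_comp m p p' u u' : u`_0 = 0 -> eqX m p p' -> eqX m u u' ->
  eqX m (p \Po u) (p' \Po u').
Proof.
case: m => [|m] u0 ep eu; first by [].
have u'0 : u'`_0 = 0 by rewrite -eu.
apply: (@eqX_trans _ (p \Po u')).
  by rewrite !comp_polyE; apply: eqX_sum => i _; apply: eqXZ; apply: eqXX.
have /eqX_dvdp/dvdpP[r e] := ep; apply/eqX_dvdp.
rewrite -comp_polyB e comp_polyM comp_Xn_poly dvdp_mull // dvdp_exp2r //.
by have [v ->] := coef0_Xfactor u'0; apply: dvdp_mulr.
Qed.

Lemma coef_Xfactor p : p != 0 -> exists j q, p = 'X^j * q /\ q`_0 != 0.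
Proof.
elim: {p}(size p) {-2}p (leqnn (size p)) => [|s IH] p.
  by rewrite leqn0 size_poly_eq0 => ->.
move=> sp p0; have [p00|p00] := eqVneq p`_0 0; last first.
  by exists 0%N, p; rewrite expr0 mul1r.
have [q def_p] := coef0_Xfactor p00; have q0 : q != 0.
  by apply: contraNneq p0 => q0; rewrite def_p q0 mulr0.
have [|j [r [def_q r0]]] := IH q _ q0.
  by move: sp; rewrite def_p mulrC size_mulX.
by exists j.+1, r; rewrite def_p def_q exprS mulrA.
Qed.

(** Substitution of u = X v with v(0) nonzero preserves the order of vanishing: if p - q = X^j r
    with r(0) nonzero, the composite is X^j v^j r(u), whose cofactor does not vanish at 0. *)
Lemma eqX_comp_inj m p q u : u`_0 = 0 -> u`_1 != 0 ->
  eqX m (p \Po u) (q \Po u) -> eqX m p q.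
Proof.
move=> u0 u1 /eqX_dvdp; rewrite -comp_polyB => dv; apply/eqX_dvdp.
have [->|d0] := eqVneq (p - q) 0; first exact: dvdp0.
have [j [r [e r0]]] := coef_Xfactor d0; rewrite e in dv *.
have [v def_u] := coef0_Xfactor u0; rewrite {}def_u in u0 u1 dv *.
rewrite coefXM /= in u1.
rewrite dvdp_mulr // dvdp_Pexp2l ?size_polyX // leqNgt; apply/negP => lt_jm.
move: dv; rewrite comp_polyM comp_Xn_poly exprMn -mulrA.
rewrite -{1}(subnKC (ltnW lt_jm)) exprD dvdp_mul2l ?monic_neq0 ?monicXn // => dv.
have dvX : 'X %| v ^+ j * (r \Po ('X * v)).
  by apply: dvdp_trans dv; rewrite dvdp_exp // subn_gt0.
move: dvX; rewrite -{1}['X]subr0 dvdp_XsubCl.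
rewrite /root horner_coef0 coef0M coef0X coef0_comp ?coefXM //.
by rewrite mulf_eq0 expf_eq0 (negPf u1) (negPf r0) andbF.
Qed.

(** Coefficient by coefficient: a multiple of X^m corrects the coefficient of X^m in p q without
    changing the lower ones. *)
Lemma polyinv_exists m p : p`_0 != 0 -> exists q, eqX m (p * q) 1.
Proof.
move=> p0; elim: m => [|m [q e]]; first by exists 0.
exists (q - ((p * q - 1)`_m / p`_0) *: 'X^m) => k; rewrite ltnS leq_eqVlt.
rewrite mulrBr -scalerAr coefB coefZ mulrC coefMXn.
case/orP=> [/eqP->|lt_km]; rewrite ?ltnn ?lt_km ?subnn.
  by rewrite mulfVK // coefB mulrC subKr.
by rewrite mulr0 subr0 mulrC; apply: e.
Qed.

Lemma eqX_size m p q : (size p <= m)%N -> (size q <= m)%N -> eqX m p q -> p = q.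
Proof.
move=> sp sq e; apply/polyP=> k; have [/e//|le_mk] := ltnP k m.
by rewrite !nth_default //; [apply: leq_trans sq _ | apply: leq_trans sp _].
Qed.

End Congruence.

(** * Series as coherent sequences of truncations; inverses for product and composition *)

Section Series.
Variable F : fieldType.
Implicit Types (s w u v : series F) (p q : {poly F}).

Definition tr m s : {poly F} := \poly_(k < m) s k.

Lemma coef_tr m s k : (k < m)%N -> (tr m s)`_k = s k.
Proof. by move=> lt_km; rewrite coef_poly lt_km. Qed.

Lemma eqX_tr m m1 m2 s : (m <= m1)%N -> (m <= m2)%N -> eqX m (tr m1 s) (tr m2 s).
Proof. by move=> le1 le2 k lt_k; rewrite !coef_tr //; lia. Qed.

Lemma tr_inj s s' : (forall m, eqX m (tr m s) (tr m s')) -> s = s'.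
Proof. by move=> e; apply: funext => k; have /(_ k) := e k.+1; rewrite !coef_tr // => ->. Qed.

(** Glues a coherent sequence, [P m] being meaningful modulo X^m only; [P k.+1] is the first term
    that determines the coefficient of X^k. *)
Definition series_lim (P : nat -> {poly F}) : series F := fun k => (P k.+1)`_k.

Lemma tr_series_lim P : (forall m, eqX m (P m.+1) (P m)) ->
  forall m, eqX m (tr m (series_lim P)) (P m).
Proof.
move=> eP m k lt_km; rewrite coef_tr // /series_lim; move: lt_km.
elim: m => // m IH; rewrite ltnS leq_eqVlt => /orP[/eqP->//|lt_km].
by rewrite IH // eP.
Qed.

Definition smul w s : series F := series_lim (fun m => tr m w * tr m s).
Definition scomp s u : series F := series_lim (fun m => tr m s \Po tr m u).

Lemma tr_smul m w s : eqX m (tr m (smul w s)) (tr m w * tr m s).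
Proof. by apply: tr_series_lim => {}m; apply: eqXM; apply: eqX_tr; lia. Qed.

Lemma tr0 m u : u 0%N = 0 -> (tr m u)`_0 = 0.
Proof. by move=> u0; rewrite coef_poly u0 if_same. Qed.

Lemma tr_scomp m s u : u 0%N = 0 -> eqX m (tr m (scomp s u)) (tr m s \Po tr m u).
Proof.
move=> u0; apply: (@tr_series_lim (fun m => tr m s \Po tr m u)) => {}m.
by apply: eqX_comp; rewrite ?tr0 //; apply: eqX_tr.
Qed.

Lemma series_inv w : w 0%N != 0 ->
  exists2 v, v 0%N != 0 & forall m, eqX m (tr m w * tr m v) 1.
Proof.
move=> w0.
(* Truncating at [m.+1] keeps the nonzero constant term even when m = 0. *)
have ex m : {q | eqX m (tr m.+1 w * q) 1}.
  by apply: cid; apply: polyinv_exists; rewrite coef_tr.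
pose P m := sval (ex m).
have eP m : eqX m (P m.+1) (P m).
  apply: (@eqX_cancel _ _ (tr m.+1 w)); first by rewrite coef_tr.
  apply: (@eqX_trans _ _ 1); last exact/eqX_sym/(svalP (ex m)).
  apply: (@eqX_trans _ _ (tr m.+2 w * P m.+1)).
    by apply: eqXM => //; apply: eqX_tr; lia.
  exact: eqX_leq (svalP (ex m.+1)).
have e m : eqX m (tr m w * tr m (series_lim P)) 1.
  apply: (@eqX_trans _ _ (tr m.+1 w * P m)); last exact: svalP (ex m).
  by apply: eqXM; [apply: eqX_tr; lia | apply: tr_series_lim].
exists (series_lim P) => //.
have /(_ 0%N isT) := e 1%N; rewrite coef0M !coef_tr // coef1 => e0.
by apply: contra_eq_neq e0 => ->; rewrite mulr0 eq_sym oner_eq0.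
Qed.

Lemma polycomp_inv_exists m (u : {poly F}) : u`_0 = 0 -> u`_1 != 0 ->
  exists q, eqX m (q \Po u) 'X.
Proof.
move=> u0 u1; have [w def_u] := coef0_Xfactor u0.
have w0 : w`_0 != 0 by move: u1; rewrite def_u coefXM.
elim: m => [|m [q e]]; first by exists 0.
exists (q - (((q \Po u) - 'X)`_m / w`_0 ^+ m) *: 'X^m) => k.
rewrite ltnS leq_eqVlt comp_polyB comp_polyZ comp_Xn_poly coefB coefZ {3}def_u.
rewrite exprMn coefXnM; case/orP=> [/eqP->|lt_km]; rewrite ?ltnn ?lt_km ?subnn.
  by rewrite coef0X mulfVK ?expf_neq0 // coefB subKr.
by rewrite mulr0 subr0; apply: e.
Qed.

Lemma series_comp_inv u : u 0%N = 0 -> u 1%N != 0 ->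
  exists v, [/\ v 0%N = 0, v 1%N != 0,
    forall m, eqX m (tr m v \Po tr m u) 'X &
    forall m, eqX m (tr m u \Po tr m v) 'X].
Proof.
move=> u0 u1.
have U0 m : (tr m u)`_0 = 0 by rewrite tr0.
have U1 m : (tr m.+2 u)`_1 != 0 by rewrite coef_tr.
have ex m : {q | eqX m (q \Po tr m.+2 u) 'X}.
  by apply: cid; apply: polycomp_inv_exists.
pose P m := sval (ex m).
have eP m : eqX m (P m.+1) (P m).
  apply: (@eqX_comp_inj _ _ _ _ (tr m.+2 u)) => //.
  apply: (@eqX_trans _ _ 'X); last exact/eqX_sym/(svalP (ex m)).
  apply: (@eqX_trans _ _ (P m.+1 \Po tr m.+3 u)).
    by apply: eqX_comp => //; apply: eqX_tr; lia.
  exact: eqX_leq (svalP (ex m.+1)).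
pose v := series_lim P.
have e m : eqX m (tr m v \Po tr m u) 'X.
  apply: (@eqX_trans _ _ (P m \Po tr m.+2 u)); last exact: svalP (ex m).
  by apply: eqX_comp => //; [apply: tr_series_lim | apply: eqX_tr; lia].
have v0 : v 0%N = 0.
  have /(_ 0%N isT) := e 1%N; rewrite coef0_comp ?(tr0 _ u0) // coef_tr // => ->.
  by rewrite coefX.
have v1 : v 1%N != 0.
  have /(_ 1%N isT) := e 2%N; have [p def_p] := coef0_Xfactor (tr0 2 v0).
  have -> : v 1%N = p`_0 by rewrite -(@coef_tr 2) // def_p coefXM.
  rewrite def_p comp_polyM comp_polyX; have [q def_q] := coef0_Xfactor (tr0 2 u0).
  rewrite {1}def_q -mulrA coefXM coef0M coef0_comp ?(tr0 _ u0) // coefX => epq.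
  by apply: contra_eq_neq epq => ->; rewrite mulr0 eq_sym oner_eq0.
exists v; split=> // -[|[|m]]; first by [].
  by case=> // _; rewrite coef0_comp ?(tr0 _ v0) // (tr0 _ u0) coefX.
(* The left inverse v is also a right inverse: u(v(u)) = u, and the outer substitution of u can be
   cancelled. *)
apply: (@eqX_comp_inj _ _ _ _ (tr m.+2 u)) => //.
rewrite -comp_polyA comp_polyX.
apply: (@eqX_trans _ _ (tr m.+2 u \Po 'X)); last by rewrite comp_polyXr.
apply: eqX_comp => //.
by rewrite coef0_comp ?(tr0 _ u0) // (tr0 _ v0).
Qed.

End Series.

(** * Parametrised arcs *)

Section Arcs.
Variables (F : fieldType) (n : nat).
Implicit Types (w u v : series F) (a b c f : vseries F n) (i j : 'I_n.+1).
Implicit Types (g h : 'M[F]_n.+1).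

Definition ent a i : series F := fun k => a k i 0.

Definition tv m a i : {poly F} := tr m (ent a i).

Lemma coef_tv m a i k : (k < m)%N -> (tv m a i)`_k = a k i 0.
Proof. exact: coef_tr. Qed.

Lemma eqX_tv m m1 m2 a i :
  (m <= m1)%N -> (m <= m2)%N -> eqX m (tv m1 a i) (tv m2 a i).
Proof. exact: eqX_tr. Qed.

Lemma ent_inj a b : (forall i, ent a i = ent b i) -> a = b.
Proof.
move=> e; apply: funext => k; apply/colP => i.
by have := congr1 (fun s : series F => s k) (e i).
Qed.

Lemma ent_mul w a i : ent (series_mul w a) i = smul w (ent a i).
Proof.
apply: funext => k; rewrite /ent /series_mul summxE /smul /series_lim coefM.
by apply: eq_bigr => l _; rewrite mxE !coef_tr //; lia.
Qed.

Lemma ent_subst a u i : ent (series_subst a u) i = scomp (ent a i) u.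
Proof.
apply: funext => k; rewrite /ent /series_subst summxE /scomp /series_lim.
have -> : tr k.+1 (ent a i) = \sum_(l < k.+1) ent a i l *: 'X^l.
  by rewrite /tr poly_def.
rewrite raddf_sum coef_sum; apply: eq_bigr => l _ /=.
by rewrite mxE linearZ /= comp_Xn_poly coefZ mulrC.
Qed.

Lemma arcP a b : arc a b <-> exists w u, [/\ w 0%N != 0, u 0%N = 0, u 1%N != 0 &
  forall m i, eqX m (tv m b i) (tr m w * (tv m a i \Po tr m u))].
Proof.
split=> -[w [u [w0 u0 u1 e]]]; exists w, u; split=> //.
  move=> m i; rewrite e /tv ent_mul ent_subst.
  by apply: eqX_trans (@tr_smul _ _ _ _) _; apply: eqXM => //; apply: tr_scomp.
apply: ent_inj => i; apply: tr_inj => m; apply: eqX_trans (e m i) _.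
rewrite ent_mul ent_subst; apply: eqX_sym.
by apply: eqX_trans (@tr_smul _ _ _ _) _; apply: eqXM => //; apply: tr_scomp.
Qed.

Lemma arc_trans a b c : arc a b -> arc b c -> arc a c.
Proof.
move=> /arcP[w [u [w0 u0 u1 e]]] /arcP[w' [u' [w0' u0' u1' e']]].
apply/arcP; exists (smul w' (scomp w u')), (scomp u u').
have uu m : eqX m (tr m (scomp u u')) (tr m u \Po tr m u') by apply: tr_scomp.
split.
- by rewrite /smul /series_lim coef0M !coef_tr // mulf_neq0 // /scomp /series_lim
    coef0_comp ?(tr0 _ u0') ?coef_tr.
- have /(_ 0%N isT) := uu 1%N; rewrite coef0_comp ?(tr0 _ u0') // (tr0 _ u0) => <-.
  by rewrite coef_tr.
- have /(_ 1%N isT) := uu 2%N; rewrite coef_tr // => ->.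
  have [p def_p] := coef0_Xfactor (tr0 2 u0).
  have [q def_q] := coef0_Xfactor (tr0 2 u0').
  rewrite def_p comp_polyM comp_polyX {1}def_q -mulrA coefXM coef0M.
  rewrite coef0_comp ?(tr0 _ u0') //= mulf_neq0 //.
    by move: u1'; rewrite -(@coef_tr _ 2) // def_q coefXM.
  by move: u1; rewrite -(@coef_tr _ 2) // def_p coefXM.
move=> m i; apply: eqX_trans (e' m i) _.
apply: (@eqX_trans _ _ (tr m w' * ((tr m w * (tv m a i \Po tr m u)) \Po tr m u'))).
  by apply: eqXM => //; apply: eqX_comp => //; apply: tr0.
rewrite comp_polyM -comp_polyA mulrA; apply: eqXM.
  apply: eqX_sym; apply: eqX_trans (@tr_smul _ _ _ _) _.
  by apply: eqXM => //; apply: tr_scomp.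
by apply: eqX_comp; [rewrite coef0_comp ?(tr0 _ u0') ?(tr0 _ u0) | | apply: eqX_sym].
Qed.

Definition sX : series F := fun k => (k == 1%N)%:R.

Lemma tr_sX m : eqX m (tr m sX) 'X.
Proof. by move=> k lt_km; rewrite coef_tr // coefX. Qed.

Lemma arc_scale a (d : F) : d != 0 -> arc a (fun k => d *: a k).
Proof.
move=> d0; apply/arcP; exists (fun k => if k is 0%N then d else 0), sX.
split; rewrite ?oner_eq0 // => m i; apply: (@eqX_trans _ _ (d *: tv m a i)).
  by move=> k lt_km; rewrite coefZ !coef_tv // mxE.
rewrite -mul_polyC; apply: eqXM.
  by move=> [|k] lt_km; rewrite coefC coef_tr.
apply: (@eqX_trans _ _ (tv m a i \Po 'X)); first by rewrite comp_polyXr.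
by apply: eqX_comp; rewrite ?coefX //; apply/eqX_sym/tr_sX.
Qed.

Lemma arc_refl a : arc a a.
Proof.
have -> : a = (fun k => 1 *: a k) by apply: funext => k; rewrite scale1r.
by have := @arc_scale a 1 (oner_neq0 _); congr (arc _ _); apply: funext => k; rewrite scale1r.
Qed.

Lemma arc_sym a b : arc a b -> arc b a.
Proof.
move=> /arcP[w [u [w0 u0 u1 e]]].
have [v [v0 v1 _ uv]] := series_comp_inv u0 u1.
have [x x0 xw] := series_inv w0.
apply/arcP; exists (scomp x v), v; split=> //.
  by rewrite /scomp /series_lim coef0_comp ?(tr0 _ v0) ?coef_tr.
move=> m i; apply: eqX_sym.
apply: (@eqX_trans _ _ ((tr m x \Po tr m v) * (tv m b i \Po tr m v))).
  by apply: eqXM => //; apply: tr_scomp.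
rewrite -comp_polyM.
apply: (@eqX_trans _ _ ((tv m a i \Po tr m u) \Po tr m v)); last first.
  rewrite -comp_polyA; apply: (@eqX_trans _ _ (tv m a i \Po 'X)).
    by apply: eqX_comp => //; rewrite coef0_comp ?(tr0 _ v0) ?(tr0 _ u0).
  by rewrite comp_polyXr.
apply: eqX_comp => //; first exact: tr0.
apply: (@eqX_trans _ _ (tr m x * (tr m w * (tv m a i \Po tr m u)))).
  exact: eqXM.
rewrite mulrA -{2}[tv m a i \Po _]mul1r; apply: eqXM => //.
by rewrite mulrC; apply: xw.
Qed.

Lemma arc_eq a b : arc a b -> arc a = arc b.
Proof.
move=> ab; apply/seteqP; split=> c; last exact: arc_trans ab.
by apply: arc_trans; apply: arc_sym.
Qed.

Definition gmul g a : vseries F n := fun k => g *m a k.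

Lemma gmulA g h a : gmul g (gmul h a) = gmul (g *m h) a.
Proof. by apply: funext => k; rewrite /gmul mulmxA. Qed.

Lemma gmul1 a : gmul 1%:M a = a.
Proof. by apply: funext => k; rewrite /gmul mul1mx. Qed.

Lemma gmul_arc g a b : arc a b -> arc (gmul g a) (gmul g b).
Proof.
move=> [w [u [w0 u0 u1 ->]]]; exists w, u; split=> //.
apply: funext => k; rewrite /gmul /series_mul mulmx_sumr.
apply: eq_bigr => l _; rewrite -scalemxAr; congr (_ *: _).
by rewrite /series_subst mulmx_sumr; apply: eq_bigr => m _; rewrite -scalemxAr.
Qed.

Lemma act_arc g a : g \in unitmx -> act g (arc a) = arc (gmul g a).
Proof.
move=> gu; apply/seteqP; split=> [_ [b ab <-]|c]; first exact: gmul_arc.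
move=> /(gmul_arc (invmx g)); rewrite gmulA mulVmx // gmul1 => ac.
by exists (gmul (invmx g) c) => //; rewrite -/(gmul g _) gmulA mulmxV // gmul1.
Qed.

Lemma arc_gmul_scale (d : F) g a : d != 0 -> arc (gmul (d *: g) a) = arc (gmul g a).
Proof.
move=> d0; apply/esym/arc_eq.
have -> : gmul (d *: g) a = (fun k => d *: gmul g a k).
  by apply: funext => k; rewrite /gmul scalemxAl.
exact: arc_scale.
Qed.

Lemma pgl_act_arc g a : g \in unitmx -> pgl_act (pgl g) (arc a) = arc (gmul g a).
Proof.
move=> gu.
have act_c (d : F) : d != 0 -> act (d *: g) (arc a) = arc (gmul g a).
  by move=> d0; rewrite act_arc ?unitmxZ ?unitfE // arc_gmul_scale.
apply/seteqP; split=> [b [_ [d d0 <-]]|b ab]; first by rewrite act_c.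
by exists (1 *: g); [exists 1 => //; apply: oner_neq0 | rewrite act_c ?oner_neq0].
Qed.

End Arcs.

(** * Affine representatives and uniqueness of normal forms *)

Section NormalForms.
Variables (F : fieldType) (n : nat).
Implicit Types (w u v : series F) (a b c f : vseries F n) (i j : 'I_n.+1).
Implicit Types (g h : 'M[F]_n.+1).

Definition affine f := eq_series (coord f 0) 1 /\ eq_series (coord f 1) 'X.

Lemma affine_tv0 m f : affine f -> eqX m (tv m f (inord 0)) 1.
Proof. by move=> [f0 _] k lt_km; rewrite coef_tv // -f0. Qed.

Lemma affine_tv1 m f : affine f -> eqX m (tv m f (inord 1)) 'X.
Proof. by move=> [_ f1] k lt_km; rewrite coef_tv // -f1. Qed.

Lemma affine_exists a : a 0%N (inord 0) 0 != 0 -> a 0%N (inord 1) 0 = 0 ->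
  a 1%N (inord 1) 0 != 0 -> exists2 f, arc a f & affine f.
Proof.
move=> a00 a01 a11; have [x x0 xa] := series_inv (a00 : ent a (inord 0) 0%N != 0).
(* s is the affine coordinate x_1/x_0 along the arc. It has order 1, and substituting its
   compositional inverse makes it the parameter. *)
pose s := smul x (ent a (inord 1)).
have s0 : s 0%N = 0.
  by rewrite /s /smul /series_lim coef0M !coef_tr // /ent a01 mulr0.
have s1 : s 1%N != 0.
  rewrite /s /smul /series_lim coefM !big_ord_recl big_ord0 !coef_tr //=.
  by rewrite /bump /= !add1n subnn /ent a01 mulr0 !addr0 mulf_neq0.
have [v [v0 v1 _ sv]] := series_comp_inv s0 s1.
pose f := series_mul (scomp x v) (series_subst a v).
have ef m i : eqX m (tv m f i) ((tr m x * tv m a i) \Po tr m v).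
  rewrite /tv /f ent_mul ent_subst comp_polyM.
  apply: eqX_trans (@tr_smul _ _ _ _) _.
  by apply: eqXM; apply: tr_scomp.
have vn m : (tr m v)`_0 = 0 by apply: tr0.
exists f.
  exists (scomp x v), v; split=> //.
  by rewrite /scomp /series_lim coef0_comp ?vn // coef_tr.
split=> k; rewrite -(@coef_tr _ k.+1) //.
  apply: (eqX_trans (ef _ _)) => //; apply: (@eqX_trans _ _ (1 \Po tr k.+1 v)).
    by apply: eqX_comp => //; rewrite mulrC; apply: xa.
  by rewrite -polyC1 comp_polyC.
apply: (eqX_trans (ef _ _)) => //; apply: eqX_trans (sv _).
by apply: eqX_comp => //; apply/eqX_sym/tr_smul.
Qed.

(* [f] agrees with the standard rational normal curve modulo [t^(n+3)] *)
Definition normal f :=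
  affine f /\ forall i, eqX (n + 3) (tv (n + 3) f i) 'X^i.

Lemma tv_gmul m g a i : tv m (gmul g a) i = \sum_j g i j *: tv m a j.
Proof.
apply/polyP => k; rewrite coef_sum coef_poly; case: ifP => lt_km.
  rewrite /ent /gmul mxE; apply: eq_bigr => j _.
  by rewrite coefZ coef_tv.
by rewrite big1 // => j _; rewrite coefZ coef_poly lt_km mulr0.
Qed.

(** The coordinate number i of the image under g of the curve (1, X, ..., X^n). *)
Definition rowp g i : {poly F} := \sum_j g i j *: 'X^j.

Lemma coef_rowp g i j : (rowp g i)`_j = g i j.
Proof.
rewrite coef_sum (bigD1 j) //= coefZ coefXn eqxx mulr1 big1 ?addr0 // => k kj.
by rewrite coefZ coefXn eq_sym (inj_eq val_inj) (negPf kj) mulr0.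
Qed.

Lemma size_rowp g i : (size (rowp g i) <= n.+1)%N.
Proof.
apply: (leq_trans (size_sum _ _ _)); apply/bigmax_leqP => j _.
by apply: (leq_trans (size_scale_leq _ _)); rewrite size_polyXn.
Qed.

Lemma tv_gmul_normal g f i : normal f ->
  eqX (n + 3) (tv (n + 3) (gmul g f) i) (rowp g i).
Proof.
by move=> [_ fn]; rewrite tv_gmul; apply: eqX_sum => j _; apply: eqXZ.
Qed.

(** Sends (1, t) to (x + y t, z t). No condition x z = 1 is imposed, since scalars act trivially on
    arcs. *)
Definition tri (x y z : F) : 'M[F]_2 :=
  \matrix_(i, j) if i == 0 then (if j == 0 then x else y)
                 else (if j == 0 then 0 else z).

Lemma sympow_tri (x y z : F) i j : sympow n (tri x y z) i j =
  ((x%:P + y%:P * 'X) ^+ (n - i) * (z%:P * 'X) ^+ i)`_j.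
Proof. by rewrite !mxE /= add0r. Qed.

Lemma size_linear_exp (p : {poly F}) k : (size p <= 2)%N -> (size (p ^+ k)%R <= k.+1)%N.
Proof.
move=> sp; apply: leq_trans (size_poly_exp_leq _ _) _.
by rewrite ltnS -{2}[k]mul1n leq_mul2r -subn1 leq_subLR addn1 sp orbT.
Qed.

Lemma size_linear (x y : F) : (size (x%:P + y%:P * 'X)%R <= 2)%N.
Proof.
apply: leq_trans (size_polyD _ _) _; rewrite geq_max.
rewrite (leq_trans (size_polyC_leq1 _)) //.
apply: leq_trans (size_polyMleq _ _) _; rewrite size_polyX addn2.
exact: size_polyC_leq1.
Qed.

Lemma rowp_sympow_tri (x y z : F) i : rowp (sympow n (tri x y z)) i =
  (x%:P + y%:P * 'X) ^+ (n - i) * (z%:P * 'X) ^+ i.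
Proof.
apply: (@eqX_size _ n.+1); first exact: size_rowp.
  apply: leq_trans (size_polyMleq _ _) _.
  have sA := size_linear_exp (n - i) (size_linear x y).
  have sB : (size ((z%:P * 'X) ^+ i)%R <= i.+1)%N.
    by apply: size_linear_exp; have := size_linear 0 z; rewrite add0r.
  by rewrite -subn1 leq_subLR (leq_trans (leq_add sA sB)) //; have := ltn_ord i; lia.
by move=> k lt_k; rewrite -[k]/(val (Ordinal lt_k)) coef_rowp sympow_tri.
Qed.

Lemma drop_rowp g i : (forall j, (j < i)%N -> g i j = 0) ->
  rowp g i = 'X^i * drop_poly i (rowp g i).
Proof.
move=> g0; rewrite -{1}(poly_take_drop i (rowp g i)) (_ : take_poly i _ = 0).
  by rewrite add0r mulrC.
apply/polyP=> k; rewrite coef_take_poly coef0; case: ifP => // lt_ki.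
have lt_k : (k < n.+1)%N by apply: ltn_trans lt_ki _.
by rewrite -[k]/(val (Ordinal lt_k)) coef_rowp g0.
Qed.

(* Both sides of [G_i = w u^i] being known modulo [t^(n+3)], the polynomials
   [H_i = G_i / t^i] of degree at most [n - i] satisfy
   [H_i H_(i+2) = H_(i+1)^2] modulo [t^(n+1-i)], which determines them from
   [H_n] and [H_(n-1)]. *)
Lemma normal_unique f f' g : (1 <= n)%N -> normal f -> normal f' ->
  arc f' (gmul g f) ->
  exists x y z s, [/\ x != 0, z != 0, s != 0 & g = s *: sympow n (tri x y z)].
Proof.
move=> n_gt0 nf [_ nf'] /arcP[w [u [w0 u0 u1 e]]].
have {e} eG i : eqX (n + 3) (rowp g i) (tr (n + 3) w * tr (n + 3) u ^+ i).
  apply: eqX_trans (eqX_sym (tv_gmul_normal _ _ nf)) _.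
  apply: eqX_trans (e _ i) _; apply: eqXM => //.
  apply: (@eqX_trans _ _ ('X^i \Po tr (n + 3) u)); last by rewrite comp_Xn_poly.
  by apply: eqX_comp => //; apply: tr0.
have [v def_u] := coef0_Xfactor (tr0 (n + 3) u0).
have {u1} v0 : v`_0 != 0.
  by move: u1; rewrite -(@coef_tr _ (n + 3)) ?addn3 // -addn3 def_u coefXM.
have {w0} : (tr (n + 3) w)`_0 != 0 by rewrite coef_tr // addn3.
move: (tr (n + 3) w) eG => W eG W0.
have {def_u} eG i : eqX (n + 3) (rowp g i) ('X^i * (W * v ^+ i)).
  by apply: eqX_trans (eG i) _; rewrite def_u exprMn mulrCA.
have g_low i j : (j < i)%N -> g i j = 0.
  move=> lt_ji; rewrite -coef_rowp eG ?coefXnM ?lt_ji //.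
  by apply: leq_trans (ltn_ord j) _; lia.
pose H k := drop_poly k (rowp g (inord k)).
have H_def k : (k <= n)%N -> rowp g (inord k) = 'X^k * H k.
  move=> le_kn; have := @drop_rowp g (inord k) (@g_low _).
  by rewrite inordK.
have sH k : (k <= n)%N -> (size (H k) <= (n - k).+1)%N.
  move=> le_kn; rewrite size_drop_poly leq_subLR; apply: leq_trans (size_rowp _ _) _.
  by lia.
have eH k : (k <= n)%N -> eqX (n + 3 - k) (H k) (W * v ^+ k).
  move=> le_kn; apply/(@eqX_mulXn _ k); rewrite -H_def // subnKC; last by lia.
  by have := eG (inord k); rewrite inordK.
have H0 k : (k <= n)%N -> (H k)`_0 != 0.
  move=> le_kn; rewrite eH //; last by lia.
  by rewrite coef0M coef0X mulf_neq0 // expf_neq0.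
pose z := (H n)`_0; pose l := H (n - 1)%N.
have z0 : z != 0 by apply: H0.
have Hn : H n = z%:P by apply: size1_polyC; have := sH n (leqnn n); rewrite subnn.
(* The geometric progression with last terms l and z, read backwards from H_n with denominators
   cleared. *)
have claim k : (k <= n)%N -> H (n - k)%N * (z ^+ k)%:P = z%:P * l ^+ k.
  elim: k {-2}k (leqnn k) => [|k IH] [|[|j]] //= le_jk le_jn.
  - by rewrite subn0 Hn !expr0.
  - by rewrite subn0 Hn !expr0.
  - by rewrite !expr1 mulrC.
  have IH1 := IH j.+1 ltac:(lia) ltac:(lia).
  have IH0 := IH j ltac:(lia) ltac:(lia).
  have sl : (size l <= 2)%N by apply: leq_trans (sH _ _) _; lia.
  (* Both sides have degree at most j + 2, and contact of order n + 3 gives H_(n-j), hence the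
     quadratic relation, modulo X^(j+3): the congruence is an equality. *)
  apply: (@eqX_size _ j.+3).
  - rewrite mulrC mul_polyC; apply: leq_trans (size_scale_leq _ _) _.
    by apply: leq_trans (sH _ _) _; lia.
  - rewrite mul_polyC; apply: leq_trans (size_scale_leq _ _) _.
    exact: size_linear_exp.
  apply: (@eqX_cancel _ _ (z%:P * l ^+ j)).
    by rewrite coef0M coefC coef0X mulf_neq0 // expf_neq0 // H0 // leq_subr.
  rewrite -{1}IH0.
  have eHH : eqX j.+3 (H (n - j)%N * H (n - j.+2)%N) (H (n - j.+1)%N ^+ 2).
    apply: (@eqX_trans _ _ ((W * v ^+ (n - j)) * (W * v ^+ (n - j.+2)))).
      by apply: eqXM; (apply: eqX_leq; last apply: eH); lia.
    rewrite mulrACA -exprD.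
    have -> : (n - j + (n - j.+2) = (n - j.+1) * 2)%N by lia.
    rewrite -expr2 exprM -exprMn; apply/eqXX/eqX_sym.
    by apply: eqX_leq; last apply: eH; lia.
  have -> : H (n - j)%N * (z ^+ j)%:P * (H (n - j.+2)%N * (z ^+ j.+2)%:P) =
     (H (n - j)%N * H (n - j.+2)%N) * (z ^+ j.+1)%:P ^+ 2.
     rewrite !polyC_exp; move: (H (n - j)%N) (H _) (z%:P) => p q r.
     by rewrite !exprS; ring.
  have -> : z%:P * l ^+ j * (z%:P * l ^+ j.+2) = (H (n - j.+1)%N * (z ^+ j.+1)%:P) ^+ 2.
    by rewrite IH1 !exprS; ring.
  by rewrite exprMn; apply: eqXM.
have l_def : l = (l`_0)%:P + (l`_1)%:P * 'X.
  apply/polyP => -[|[|k]]; rewrite coefD coefC coefMX coefC /= ?addr0 ?add0r //.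
  by apply: nth_default; apply: leq_trans (sH _ _) _; lia.
(* By the claim, H_i = z (l/z)^(n-i) = (z / z^n) l^(n-i) z^i, which is row i of the symmetric power
   up to the scalar z / z^n. *)
exists l`_0, l`_1, z, (z / z ^+ n); split=> //.
- by apply: H0; lia.
- by rewrite mulf_neq0 // invr_eq0 expf_neq0.
apply/matrixP => i j; rewrite mxE -!coef_rowp rowp_sympow_tri -l_def -coefZ.
have le_in : (i <= n)%N by rewrite -ltnS.
have -> : rowp g i = 'X^i * H i by rewrite -H_def // inord_val.
apply: (congr1 (fun p : {poly F} => p`_j)); apply: (@mulfI _ ((z ^+ (n - i))%:P)).
  by rewrite polyC_eq0 expf_neq0.
have := claim (n - i)%N (leq_subr _ _); rewrite subKn // => cl.
rewrite mulrCA [_%:P * H i]mulrC cl exprMn -mul_polyC.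
have -> : (z / z ^+ n)%:P = z%:P * ((z ^+ n)^-1)%:P by rewrite -polyCM.
have : (z ^+ (n - i))%:P * (z%:P ^+ i) * ((z ^+ n)^-1)%:P = 1 :> {poly F}.
  by rewrite -polyC_exp -!polyCM -exprD subnK // mulfV ?expf_neq0.
move: ((z ^+ (n - i))%:P) (z%:P ^+ i) (((z ^+ n)^-1)%:P) => p q r pqr.
rewrite -[LHS]mul1r -pqr; ring.
Qed.

End NormalForms.

(** * Action of the Borel subgroup on normal forms *)

Section Transfer.
Variable F : fieldType.

Lemma eqX_affine_reparam n m (f b : vseries F n) (w u : series F) : u 0%N = 0 ->
  affine f -> (forall i, eqX m (tv m b i) (tr m w * (tv m f i \Po tr m u))) ->
  eqX m (tr m w) (tv m b (inord 0)) /\ eqX m (tr m w * tr m u) (tv m b (inord 1)).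
Proof.
move=> u0 af e; split; apply: eqX_sym; apply: eqX_trans (e _) _.
  rewrite -[X in eqX _ _ X]mulr1; apply: eqXM => //.
  apply: (@eqX_trans _ _ (1 \Po tr m u)); last by rewrite -polyC1 comp_polyC.
  by apply: eqX_comp; rewrite ?tr0 //; apply: affine_tv0.
apply: eqXM => //; apply: (@eqX_trans _ _ ('X \Po tr m u)); last by rewrite comp_polyX.
by apply: eqX_comp; rewrite ?tr0 //; apply: affine_tv1.
Qed.

(* For a representative [b = w f(u)] of the arc of an affine series [f],
   [b_i b_0^(i-1) - b_1^i = w^i (f_i - t^i)(u)], and the left hand side vanishes
   identically on the standard rational normal curve. *)
Lemma reparam_defect n m (f b : vseries F n) (w u : series F) (i : 'I_n.+1) :
  (0 < i)%N -> u 0%N = 0 ->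
  affine f -> (forall i, eqX m (tv m b i) (tr m w * (tv m f i \Po tr m u))) ->
  eqX m (tr m w ^+ i * ((tv m f i - 'X^i) \Po tr m u))
    (tv m b i * tv m b (inord 0) ^+ i.-1 - tv m b (inord 1) ^+ i).
Proof.
move=> i_gt0 u0 af e; have [e0 e1] := eqX_affine_reparam u0 af e.
rewrite comp_polyB comp_Xn_poly mulrBr -exprMn; apply: eqXB; last exact: eqXX.
rewrite -{1}(prednK i_gt0) exprSr -mulrA mulrC; apply: eqXM; last exact: eqXX.
exact/eqX_sym.
Qed.

(** Compare the coefficients of t^(n+3) in [reparam_defect]. As w(0) = x^n and u = (z/x) t + ...,
    the left one is x^(n i) (z/x)^(n+3) times that of f'_i. The right one is x^(n(i-1)) times that
    of the perturbation of the i-th coordinate: for i >= 2, the perturbations of the coordinates 0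
    and 1 contribute in higher degree only. *)
Lemma transfer n (f f' : vseries F n) (x y z : F) : (2 <= n)%N ->
  x != 0 -> z != 0 -> normal f -> affine f' ->
  arc f' (gmul (sympow n (tri x y z)) f) ->
  normal f' /\ forall i : 'I_n.+1, (2 <= i)%N ->
    z ^+ (n + 3) * f' (n + 3)%N i 0 =
    x ^+ 3 * \sum_j sympow n (tri x y z) i j * f (n + 3)%N j 0.
Proof.
move=> n2 x0 z0 nf af' /arcP[w [u [w0 u0 u1 /(_ (n + 3).+1)]]].
set N := (n + 3)%N; set S := sympow n _ => e.
have ltnN : (n < N)%N by rewrite /N; lia.
have [eW eU] := eqX_affine_reparam u0 af' e.
have [v def_u] := coef0_Xfactor (tr0 N.+1 u0).
have v0 : v`_0 != 0 by move: u1; rewrite -(@coef_tr _ N.+1) ?def_u ?coefXM //; lia.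
pose L : {poly F} := x%:P + y%:P * 'X.
have L0 : L`_0 = x by rewrite coefD coefC coefMX /= addr0.
pose G i := rowp S i.
have GE i : G i = L ^+ (n - i) * (z%:P * 'X) ^+ i by apply: rowp_sympow_tri.
pose E i := \sum_j S i j * f N j 0.
have eB i : eqX N.+1 (tv N.+1 (gmul S f) i) (G i + (E i)%:P * 'X^N).
  have -> : (E i)%:P = \sum_j (S i j * f N j 0)%:P by rewrite /E rmorph_sum.
  rewrite tv_gmul mulr_suml -big_split; apply: eqX_sum => j _ /=.
  rewrite polyCM -mulrA mul_polyC -scalerDr; apply: eqXZ => k.
  rewrite ltnS leq_eqVlt coefD coefCM !coefXn => /orP[/eqP->|lt_kN].
    by rewrite coef_tv // eqxx mulr1 gtn_eqF ?add0r //; have := ltn_ord j; lia.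
  rewrite (ltn_eqF lt_kN) mulr0 addr0 -coefXn -(proj2 nf j k lt_kN).
  by rewrite !coef_tv //; lia.
have eBN i : eqX N (tv N.+1 (gmul S f) i) (G i).
  apply: (@eqX_trans _ _ (G i + (E i)%:P * 'X^N)); first exact: eqX_leq (eB i).
  by move=> k lt_kN; rewrite coefD coefMXn lt_kN addr0.
have N0 : (0 < N)%N by lia.
have W0 : (tr N.+1 w)`_0 = x ^+ n.
  rewrite eW // eBN // GE inordK // subn0 expr0 mulr1 coef0X L0 //.
have Wv : x ^+ n * v`_0 = x ^+ n.-1 * z.
  rewrite -W0 -coef0M.
  have := eU 1%N; rewrite ltnS N0 => /(_ isT); rewrite def_u mulrCA coefXM /= => ->.
  rewrite eBN; last by rewrite /N; lia.
  rewrite GE inordK; last by lia.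
  rewrite expr1 mulrA coefMX /= subn1 coef0M coef0X L0 coefC //.
have xv : x * v`_0 = z.
  apply: (@mulfI _ (x ^+ n.-1)); first by rewrite expf_neq0.
  by rewrite mulrA -exprSr prednK //; lia.
have defect (i : 'I_n.+1) : (2 <= i)%N ->
    eqX N.+1 (tr N.+1 w ^+ i * ((tv N.+1 f' i - 'X^i) \Po tr N.+1 u))
      ((E i * x ^+ (n * i.-1))%:P * 'X^N).
  move=> i2; apply: eqX_trans (reparam_defect _ u0 af' e) _; first by lia.
  have -> : (E i * x ^+ (n * i.-1))%:P * 'X^N =
    G i * G (inord 0) ^+ i.-1 + (E i * x ^+ (n * i.-1))%:P * 'X^N - G (inord 1) ^+ i.
    rewrite addrAC !GE !inordK ?subn0; try lia.
    rewrite expr0 mulr1 expr1; move: (z%:P * 'X) (_ * 'X^N) => Z C.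
    rewrite exprMn -!exprM [L ^+ _ * Z ^+ _ * _]mulrAC -exprD.
    have -> : (n - i + n * i.-1 = (n - 1) * i)%N.
      by have := ltn_ord i; rewrite ltnS => le_in; nia.
    by rewrite subrr add0r.
  apply: eqXB.
    apply: (@eqX_trans _ _ ((G i + (E i)%:P * 'X^N) * tv N.+1 (gmul S f) (inord 0) ^+ i.-1)).
      by apply: eqXM => //; apply: eB.
    rewrite mulrDl; apply: eqXD.
      (* The factor X of G_i raises the congruence between b_0 and G_0 from order N to order N +
         1. *)
      have -> : G i = 'X^1 * (L ^+ (n - i) * (z%:P ^+ i * 'X^(i.-1))).
        rewrite GE exprMn expr1.
        have -> : 'X^i = 'X * 'X^(i.-1) :> {poly F} by rewrite -exprS prednK // ltnW.
        ring.
      rewrite -!mulrA -add1n; apply/eqX_mulXn; rewrite !mulrA; apply: eqXM => //.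
      exact: eqXX.
    rewrite polyCM -!mulrA [(x ^+ _)%:P * _]mulrC; apply: eqXM => //.
    apply: (@eqX_leq _ (N + 1)); first by rewrite addn1.
    apply/eqX_mulXn => -[|//] _.
    by rewrite coef0X eBN // GE inordK // subn0 expr0 mulr1 coef0X L0 coefC exprM.
  have Xf (p : {poly F}) : eqX N p (G (inord 1)) -> exists q, p = 'X * q.
    move=> e1; apply: coef0_Xfactor; rewrite e1 // GE inordK ?expr1; last by lia.
    by rewrite mulrA coefMX.
  have [b1 e1] := Xf _ (eBN _); have [g1 e2] := Xf _ (@eqX_refl _ _ _).
  have := eBN (inord 1); rewrite e1 e2 -['X]expr1 -/N -(subnKC N0) => /eqX_mulXn eb.
  (* b_1 / X and G_1 / X agree modulo X^(N-1), so the i-th powers of b_1 and G_1 agree modulo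
     X^(N-1+i), which suffices because i >= 2. *)
  rewrite !exprMn expr1; apply: (@eqX_leq _ (i + (N - 1))); first by lia.
  by apply/eqX_mulXn/eqXX.
have low (i : 'I_n.+1) : (2 <= i)%N -> eqX N (tv N.+1 f' i - 'X^i) 0.
  move=> i2; apply: (@eqX_comp_inj _ _ _ _ (tr N.+1 u)); rewrite ?tr0 //.
    by rewrite coef_tr //; lia.
  rewrite comp_poly0; apply: (@eqX_cancel _ _ (tr N.+1 w ^+ i)).
    by rewrite coef0X W0 !expf_neq0.
  rewrite mulr0; apply: (@eqX_trans _ _ ((E i * x ^+ (n * i.-1))%:P * 'X^N)).
    exact: eqX_leq (defect i i2).
  by move=> k lt_kN; rewrite coefMXn lt_kN coef0.
split=> [|i i2].
  split=> // i k lt_kN; have [i2|] := leqP 2 i.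
    move/eqP: (low i i2 k lt_kN); rewrite coefB coef0 subr_eq0 => /eqP <-.
    by rewrite !coef_tv //; lia.
  case: i => -[|[|//]] Hi _; [move: (@affine_tv0 _ _ N _ af')|move: (@affine_tv1 _ _ N _ af')];
    by move=> /(_ k lt_kN); rewrite ?expr0 ?expr1 => <-; congr ((tv _ _ _)`_ _);
    apply: val_inj; rewrite /= inordK.
have [r er] := eqX0_factor (low i i2).
have := defect i i2 N (leqnn _); rewrite er comp_polyM comp_Xn_poly def_u exprMn.
rewrite -mulrA mulrCA coefXnM coefMXn ltnn subnn !coef0M !coef0X W0.
rewrite coef0_comp ?coefXM // coefC /=.
have -> : f' N i 0 = r`_0.
  have : (tv N.+1 f' i - 'X^i)`_N = r`_0 by rewrite er coefXnM ltnn subnn.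
  rewrite coefB coefXn coef_tv // gtn_eqF ?subr0 //.
  by have := ltn_ord i; lia.
have -> : (x ^+ n) ^+ i = x ^+ (n * i.-1) * x ^+ n.
  by rewrite -exprM -exprD; congr (_ ^+ _); nia.
rewrite -[\sum_j _]/(E i) -mulrA [E i * _]mulrC => /(mulfI (expf_neq0 _ x0)) <-.
by rewrite -xv exprMn /N exprD; ring.
Qed.

(** The form x_0 x_2 - x_1^2 is multiplied by (x z)^2 under S and equals phi on (1, t, t^2 + phi).
    The defect is thus known exactly, including the terms quadratic in phi, and the coefficient of
    t^6 can be read off from w = L^2 and L v = z modulo t^2. *)
Lemma transfer_conic (f f' : vseries F 2) (x y z : F) :
  x != 0 -> z != 0 -> normal f -> normal f' ->
  arc f' (gmul (sympow 2 (tri x y z)) f) ->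
  z ^+ 4 * f' 6%N ord_max 0 = x ^+ 3 * (x * f 6%N ord_max 0 + y * f 5%N ord_max 0).
Proof.
move=> x0 z0 nf nf' /arcP[w [u [w0 u0 u1 /(_ 7%N)]]].
set S := sympow 2 _ => e.
have [eW eU] := eqX_affine_reparam u0 (proj1 nf') e.
have [v def_u] := coef0_Xfactor (tr0 7%N u0).
pose L : {poly F} := x%:P + y%:P * 'X.
have L0 : L`_0 = x by rewrite coefD coefC coefMX /= addr0.
have eQ (h : vseries F 2) : normal h -> eqX 7 (tv 7 h ord_max)
    ('X^2 + 'X^5 * ((h 5%N ord_max 0)%:P + (h 6%N ord_max 0)%:P * 'X)).
  move=> nh k lt_k7; rewrite coefD coefXn coefXnM.
  case: (ltnP k 5) => [lt_k5|].
    by have := proj2 nh ord_max k lt_k5; rewrite !coef_tv // coefXn addr0.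
  move: lt_k7; case: k => [|[|[|[|[|[|[|//]]]]]]] //= _ _; rewrite coef_tv //.
    by rewrite coefD coefC coefMX addr0 add0r.
  by rewrite coefD coefC coefMX coefC !add0r.
have ord2 (i : 'I_3) : [\/ i = inord 0, i = inord 1 | i = ord_max].
  case: i => -[|[|[|//]]] Hi; [apply: Or31|apply: Or32|apply: Or33]; apply: val_inj;
  by rewrite /= ?inordK.
pose phi : {poly F} := 'X^5 * ((f 5%N ord_max 0)%:P + (f 6%N ord_max 0)%:P * 'X).
have eB i : eqX 7 (tv 7 (gmul S f) i) (rowp S i + (S i ord_max)%:P * phi).
  rewrite tv_gmul /rowp !big_ord_recr !big_ord0 /= !add0r -[X in eqX _ _ X]addrA.
  have e0 : eqX 7 (tv 7 f (widen_ord (leqnSn 2) (widen_ord (leqnSn 1) ord_max))) 'X^0.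
    rewrite expr0; apply: eqX_trans (@affine_tv0 _ _ 7%N _ (proj1 nf)).
    by rewrite (_ : widen_ord _ _ = inord 0) //; apply: val_inj; rewrite /= inordK.
  have e1 : eqX 7 (tv 7 f (widen_ord (leqnSn 2) ord_max)) 'X^1.
    rewrite expr1; apply: eqX_trans (@affine_tv1 _ _ 7%N _ (proj1 nf)).
    by rewrite (_ : widen_ord _ _ = inord 1) //; apply: val_inj; rewrite /= inordK.
  apply: eqXD; first by apply: eqXD; apply: eqXZ.
  by rewrite mul_polyC -scalerDr; apply: eqXZ; apply: eQ.
have S2 i : S i ord_max = [:: y ^+ 2; y * z; z ^+ 2]`_i.
  rewrite -coef_rowp rowp_sympow_tri; case: (ord2 i) => -> /=; rewrite ?inordK //=.
  - rewrite subn0 expr0 mulr1 expr2 !(coefM, coefD, coefC, coefX, big_ord_recl, big_ord0) /=.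
    by rewrite /bump /=; ring.
  - rewrite !expr1 !(coefM, coefD, coefC, coefX, big_ord_recl, big_ord0) /=.
    by rewrite /bump /=; ring.
  - rewrite subnn expr0 mul1r expr2 !(coefM, coefD, coefC, coefX, big_ord_recl, big_ord0) /=.
    by rewrite /bump /=; ring.
have := reparam_defect (isT : (0 < (ord_max : 'I_3))%N) u0 (proj1 nf') e.
have B0 : eqX 7 (tv 7 (gmul S f) (inord 0)) (L ^+ 2 + (y ^+ 2)%:P * phi).
  apply: eqX_trans (eB _) _; rewrite S2 rowp_sympow_tri inordK //=.
  by rewrite subn0 expr0 mulr1.
have B1 : eqX 7 (tv 7 (gmul S f) (inord 1)) (L * (z%:P * 'X) + (y * z)%:P * phi).
  by apply: eqX_trans (eB _) _; rewrite S2 rowp_sympow_tri inordK //=.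
have B2 : eqX 7 (tv 7 (gmul S f) ord_max) ((z%:P * 'X) ^+ 2 + (z ^+ 2)%:P * phi).
  apply: eqX_trans (eB _) _; rewrite S2 rowp_sympow_tri /=.
  by rewrite subnn expr0 mul1r.
move=> def; have {def} := eqX_trans def (eqXB (eqXM B2 B0) (eqXX 2 B1)).
have -> : ((z%:P * 'X) ^+ 2 + (z ^+ 2)%:P * phi) * (L ^+ 2 + (y ^+ 2)%:P * phi) -
   (L * (z%:P * 'X) + (y * z)%:P * phi) ^+ 2 = (z ^+ 2 * x ^+ 2)%:P * phi.
  by rewrite /L; move: (phi) => p; rewrite !(polyCM, polyC_exp); ring.
move=> def.
pose phi' : {poly F} := 'X^5 * ((f' 5%N ord_max 0)%:P + (f' 6%N ord_max 0)%:P * 'X).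
have phi'u : phi' \Po tr 7 u = 'X^5 * (v ^+ 5 *
    ((f' 5%N ord_max 0)%:P + (f' 6%N ord_max 0)%:P * ('X * v))).
  rewrite /phi' comp_polyM comp_Xn_poly comp_polyD comp_polyM !comp_polyC comp_polyX.
  by rewrite def_u exprMn mulrA.
have {def} : eqX 7 (tr 7 w ^+ 2 * (phi' \Po tr 7 u)) ((z ^+ 2 * x ^+ 2)%:P * phi).
  apply: eqX_trans def; apply: eqXM => //; apply: eqX_comp; rewrite ?tr0 //.
  apply: (@eqX_trans _ _ ('X^2 + phi' - 'X^2)); first by rewrite addrAC subrr add0r.
  by apply: eqXB => //; apply: eqX_sym; apply: eQ.
rewrite phi'u mulrCA /phi [_%:P * ('X^5 * _)]mulrCA => /(@eqX_mulXn _ 5 2 _ _) def.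
have eWL : eqX 2 (tr 7 w) (L ^+ 2).
  apply: (eqX_trans (eqX_leq _ eW)) => //; apply: (eqX_trans (eqX_leq _ B0)) => //.
  by move=> k lt_k; rewrite coefD /phi mulrCA coefXnM; case: ifP; rewrite ?addr0 //; lia.
have eLv : eqX 2 (L * v) z%:P.
  have e1 := eqX_trans eU B1.
  have {}e1 : eqX (1 + 2) ('X^1 * (tr 7 w * v)) ('X^1 * (L * z%:P)).
    apply: (@eqX_trans _ _ (L * (z%:P * 'X) + (y * z)%:P * phi)).
      by rewrite mulrCA expr1 -def_u; apply: eqX_leq e1.
    move=> k lt_k; rewrite expr1 coefD /phi [_%:P * ('X^5 * _)]mulrCA coefXnM.
    have lt5 : (k < 5)%N by apply: leq_trans lt_k _.
    rewrite lt5 addr0.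
    by rewrite ['X * _]mulrC mulrA.
  move/eqX_mulXn: e1 => e1; apply: (@eqX_cancel _ _ L); first by rewrite L0.
  apply: eqX_trans e1; rewrite mulrA -expr2; apply: eqXM => //; exact: eqX_sym.
(* Multiplying by L turns w^2 v^5 = L^4 v^5 into (L v)^5 = z^5; the only v left is the one inside
   the linear factor. *)
have {def} : eqX 2 ((z ^+ 5)%:P * ((f' 5%N ord_max 0)%:P + (f' 6%N ord_max 0)%:P * ('X * v)))
   (L * ((z ^+ 2 * x ^+ 2)%:P * ((f 5%N ord_max 0)%:P + (f 6%N ord_max 0)%:P * 'X))).
  apply: eqX_trans (eqXM (@eqX_refl _ _ L) def).
  move: (_%:P + _%:P * ('X * v)) => A; rewrite [_ * (_ * A)]mulrA mulrA.
  apply: eqXM => //.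
  apply: (@eqX_trans _ _ (L * ((L ^+ 2) ^+ 2 * v ^+ 5))); last first.
    by apply: eqXM => //; apply: eqXM => //; apply: eqX_sym; apply: eqXX.
  have -> : L * ((L ^+ 2) ^+ 2 * v ^+ 5) = (L * v) ^+ 5 by ring.
  by rewrite polyC_exp; apply: eqX_sym; apply: eqXX.
move=> /(_ 1%N isT); rewrite coefCM coefD coefC mulrCA coefXM coef0M !coefC /=.
rewrite mulrCA coefCM /L !(coefM, coefD, coefC, coefX, big_ord_recl, big_ord0) /=.
rewrite /bump /= => e1.
have Lv0 : x * v`_0 = z by rewrite -L0 -coef0M eLv // coefC.
apply: (@mulfI _ (z ^+ 2)); first by rewrite expf_neq0.
have {}e1 : x * (z ^+ 5 * (f' 6%N ord_max 0 * v`_0)) =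
  x * (z ^+ 2 * x ^+ 2 * (x * f 6%N ord_max 0 + y * f 5%N ord_max 0)).
  by congr (x * _); move: e1; rewrite !(mulr0, mulr1, addr0, add0r) => ->; ring.
transitivity (z ^+ 5 * f' 6%N ord_max 0 * z); first by ring.
rewrite -{2}Lv0; transitivity (x * (z ^+ 5 * (f' 6%N ord_max 0 * v`_0))); first by ring.
by rewrite e1; ring.
Qed.

End Transfer.

(** * Existence of normal forms *)

Section Existence.
Variables (F : fieldType) (n : nat).
Hypothesis n2 : (2 <= n)%N.
Implicit Types (a b f : vseries F n).

Definition jetmx a : 'M[F]_n.+1 := \matrix_(i < n.+1, j < n.+1) a j i 0.

(** By Cramer's rule, [\det (jetmx a)] times the coordinate of a_(n+k) on a_i; the adjugate keeps it
    polynomial in the coefficients of a. *)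
Definition cramer a (k : nat) (i : nat) : F := (\adj (jetmx a) *m a (n + k)%N) (inord i) 0.

(* If [al k i] is the coordinate of [a_(n+k)] on [a_i] in the basis
   [a_0, ..., a_n], this is [det (a_0, ..., a_n) ^ 3] times
   [al 3 n - 2 al 2 (n-1) + al 1 (n-2) - 3 (al 1 n) (al 2 n)
    + 3 (al 1 n) (al 1 (n-1)) + 2 (al 1 n)^3],
   the coefficient [c_n] of the normal form of [a]. *)
Definition monge_poly a : F :=
  let w := \det (jetmx a) in
  w ^+ 2 * (cramer a 3 n - 2%:R * cramer a 2 (n - 1) + cramer a 1 (n - 2))
  - 3%:R * w * cramer a 1 n * cramer a 2 n
  + 3%:R * w * cramer a 1 n * cramer a 1 (n - 1) + 2%:R * cramer a 1 n ^+ 3.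

(** * Arcs whose first n + 1 coefficients form the standard basis *)

Section Reduction.
Variable b : vseries F n.
Hypothesis b_id : forall (k : nat) (i : 'I_n.+1), (k <= n)%N -> b k i 0 = (k == i)%:R.

Let M := (n + 4)%N.
Let P (j : 'I_n.+1) := drop_poly j (tv M b j).

Lemma tv_P j : tv M b j = 'X^j * P j.
Proof.
rewrite -{1}(poly_take_drop j (tv M b j)) (_ : take_poly j _ = 0).
  by rewrite add0r mulrC.
apply/polyP=> k; rewrite coef_take_poly coef0; case: ifP => // lt_kj.
have lt_kn : (k < n)%N by apply: leq_trans lt_kj _; rewrite -ltnS.
by rewrite coef_tv ?b_id ?(ltn_eqF lt_kj) // /M; lia.
Qed.

Lemma coef_P (j : 'I_n.+1) k : (j + k < M)%N -> (P j)`_k = b (j + k)%N j 0.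
Proof. by move=> lt_k; rewrite coef_drop_poly addnC coef_tv. Qed.

Lemma P_1 (j : 'I_n.+1) : eqX (n.+1 - j) (P j) 1.
Proof.
move=> k lt_k; rewrite coef_P ?b_id /M; try lia.
by rewrite coef1 -[X in _ == X]addn0 eqn_add2l.
Qed.

(** X^i Q_i is the combination of the coordinates j >= i with coefficients T_(j-i). As P_j = 1 to
    the relevant order, Q_i = T modulo X^(n+1-i), so Q_i can be prescribed to that precision. *)
Let Q i (T : {poly F}) : {poly F} :=
  \sum_(j < n.+1 | (i <= j)%N) T`_(j - i) *: ('X^(j - i) * P j).

Lemma Q_T i T : (i <= n)%N -> eqX (n.+1 - i) (Q i T) T.
Proof.
move=> le_in k lt_k; rewrite coef_sum.
have lt_ik : (i + k < n.+1)%N by lia.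
rewrite (bigD1 (Ordinal lt_ik)) ?leq_addr //= addKn coefZ coefXnM ltnn subnn.
rewrite P_1 ?coef1 /= ?mulr1; last by lia.
rewrite big1 ?addr0 // => j /andP[le_ij]; rewrite -val_eqE /= => ne_j.
rewrite coefZ coefXnM; case: ltnP => lt_jk; first by rewrite mulr0.
rewrite P_1 ?coef1; last by lia.
by rewrite (_ : _ == _ = false) ?mulr0 //; apply/eqP; move/eqP: ne_j; lia.
Qed.

(* Suitable combinations [X^i Q_i] of the coordinates number [i, ..., n] of [b]
   are in geometric progression as far as possible. *)
Lemma progression_exists : exists (t q : nat -> {poly F}),
  [/\ forall i, (i <= n)%N -> (q i)`_0 = 1,
      forall i, q i = Q i (t i),
      t n = 1, t (n - 1)%N = 1 &
      forall i, (i.+2 <= n)%N -> eqX (n.+1 - i) (q i * q i.+2) (q i.+1 ^+ 2)].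
Proof.
have [inv invP] : {inv : {poly F} -> {poly F} &
    forall p : {poly F}, p`_0 != 0 -> eqX n.+1 (p * inv p) 1}.
  apply: (choice (P := fun p q : {poly F} => p`_0 != 0 -> eqX n.+1 (p * q) 1)) => p.
  have [p0|p0] := eqVneq p`_0 0; first by exists 0.
  by have [q e] := polyinv_exists n.+1 p0; exists q.
(* Indexing by k = n - i, the state holds two consecutive T's. The next T is the value Q_(i+1)^2 /
   Q_(i+2) required of Q_i; taking it as T is legitimate because Q_i agrees with T to the required
   precision. *)
pose step k (x : {poly F} * {poly F}) :=
  (x.2, Q (n - k.+1) x.2 ^+ 2 * inv (Q (n - k) x.1)).
pose s := fix s k := if k is k.+1 then step k (s k) else (1, 1) : {poly F} * {poly F}.
pose t k := (s k).1.
have tSS k : t k.+2 = Q (n - k.+1) (t k.+1) ^+ 2 * inv (Q (n - k) (t k)) by [].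
have Q0 i T : (i <= n)%N -> (Q i T)`_0 = T`_0 by move=> le_in; apply: Q_T; lia.
have t0 k : (t k)`_0 = 1.
  suff: (t k)`_0 = 1 /\ (t k.+1)`_0 = 1 by case.
  elim: k => [|k [IH0 IH1]]; first by rewrite coef1.
  split=> //; rewrite tSS coef0M coef0X Q0 ?leq_subr // IH1 expr1n mul1r.
  have /(_ _) e := invP (Q (n - k) (t k)).
  have := e _ 0%N isT; rewrite coef0M Q0 ?leq_subr // IH0 coef1 mul1r; apply.
  exact: oner_neq0.
exists (fun i => t (n - i)%N), (fun i => Q i (t (n - i)%N)); split=> //.
- by move=> i le_in; rewrite Q0.
- by rewrite subnn.
- by rewrite subKn //; apply: ltnW.
move=> i le_in.
have -> : (n - i = (n - i.+2).+2)%N by lia.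
have -> : (n - i.+1 = (n - i.+2).+1)%N by lia.
move: (t0 (n - i.+2)%N) => tk0.
apply: (@eqX_trans _ _ (t (n - i.+2).+2 * Q i.+2 (t (n - i.+2)%N))).
  by apply: eqXM => //; apply: Q_T; lia.
rewrite tSS -mulrA -[X in eqX _ _ X]mulr1.
have -> : (n - (n - i.+2).+1 = i.+1)%N by lia.
have -> : (n - (n - i.+2) = i.+2)%N by lia.
apply: eqXM => //; rewrite mulrC; apply: (@eqX_leq _ n.+1); first by lia.
by apply: invP; rewrite Q0 // tk0 oner_neq0.
Qed.

(** The coordinates X^i q_i form a geometric progression modulo X^(n+3) with ratio u = X q_1/q_0;
    taking u as parameter gives the normal form. The coefficient c_n is that of X^3 in q_(n-2) q_n -
    q_(n-1)^2, a relation which holds modulo X^3. *)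
Lemma normal_form_id : exists g f,
  [/\ g \in unitmx, arc (gmul g b) f, normal f &
   f (n + 3)%N ord_max 0 = b (n + 3)%N ord_max 0
     - 2%:R * b (n + 2)%N (inord (n - 1)) 0 + b (n + 1)%N (inord (n - 2)) 0
     - 3%:R * b (n + 1)%N ord_max 0 * b (n + 2)%N ord_max 0
     + 3%:R * b (n + 1)%N ord_max 0 * b (n + 1)%N (inord (n - 1)) 0
     + 2%:R * b (n + 1)%N ord_max 0 ^+ 3].
Proof.
have [t [q [q0 qE tn tn1 qq]]] := progression_exists.
pose g : 'M[F]_n.+1 := \matrix_(i, j) if (i <= j)%N then (t i)`_(j - i) else 0.
have t0 i : (i <= n)%N -> (t i)`_0 = 1.
  by move=> le_in; rewrite -(q0 i) // qE (Q_T (t i) le_in) //; lia.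
have gu : g \in unitmx.
  rewrite unitmxE -det_tr det_trig; last first.
    by apply/is_trig_mxP => i j lt_ij; rewrite !mxE leqNgt lt_ij.
  rewrite big1 ?unitr1 // => i _; rewrite !mxE leqnn subnn t0 //.
  by rewrite -ltnS.
pose B := gmul g b.
have tvB i : tv M B i = 'X^i * q i.
  rewrite tv_gmul qE mulr_sumr (bigID (fun j : 'I_n.+1 => (i <= j)%N)) /=.
  rewrite [X in _ + X]big1 ?addr0 => [|j /negPf lt_ji]; last first.
    by rewrite mxE lt_ji scale0r.
  apply: eq_bigr => j le_ij; rewrite mxE le_ij tv_P -scalerAr mulrA -exprD.
  by rewrite subnKC.
have coefB i k : (k < M)%N -> B k i 0 = ('X^i * q i)`_k.
  by move=> lt_k; rewrite -tvB coef_tv.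
have M4 : (4 <= M)%N by rewrite /M; lia.
have i0 : (inord 0 : 'I_n.+1) = 0%N :> nat by rewrite inordK.
have i1 : (inord 1 : 'I_n.+1) = 1%N :> nat by rewrite inordK //; lia.
have [f Bf af] : exists2 f, arc B f & affine f.
  apply: affine_exists; rewrite coefB ?coefXnM ?i0 ?i1 //=; try lia.
    by rewrite q0 ?oner_neq0.
  by rewrite q0 ?oner_neq0 //; lia.
have /arcP[w [u [w0 u0 u1 /(_ M) e]]] := arc_sym Bf.
have [eW eU] := eqX_affine_reparam u0 af e.
have [v def_u] := coef0_Xfactor (tr0 M u0).
rewrite !tvB i0 i1 expr0 mul1r expr1 in eW eU.
have W0 : (tr M w)`_0 = 1 by rewrite eW ?q0 //; lia.
have qv0 : eqX (n + 3) (q 0%N * v) (q 1%N).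
  apply/(@eqX_mulXn _ 1); rewrite expr1 mulrCA -def_u.
  apply: (@eqX_leq _ M); first by rewrite /M; lia.
  by apply: eqX_trans eU; apply: eqXM => //; apply: eqX_sym.
have v0 : v`_0 = 1.
  have := qv0 0%N; rewrite coef0M !q0 ?mul1r //; last by lia.
  by apply; lia.
(* Modulo X^(n+2-i) is the right precision: the factor X^(i+1) of the coordinate i + 1 brings it to
   n + 3. *)
have chain i : (i < n)%N -> eqX (n + 2 - i) (q i * v) (q i.+1).
  elim: i => [|i IH] lt_in; first by apply: eqX_leq qv0; lia.
  apply: (@eqX_cancel _ _ (q i)); first by rewrite q0 ?oner_neq0 //; lia.
  rewrite mulrCA; apply: (@eqX_trans _ _ (q i.+1 * q i.+1)).
    by apply: eqXM => //; apply: eqX_leq (IH _); lia.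
  by rewrite -expr2; apply: eqX_sym; apply: eqX_leq (qq _ _); lia.
have wu i : (i <= n)%N -> eqX (n + 3) (tr M w * tr M u ^+ i) ('X^i * q i).
  elim: i => [|i IH] le_in.
    by rewrite expr0 mulr1 mul1r; apply: eqX_leq eW; rewrite /M; lia.
  rewrite exprSr mulrA; apply: (@eqX_trans _ _ ('X^i * q i * tr M u)).
    by apply: eqXM => //; apply: IH; lia.
  rewrite def_u mulrACA -exprSr; apply: (@eqX_leq _ (i.+1 + (n + 2 - i))); first by lia.
  exact/eqX_mulXn/chain.
have nf : normal f.
  split=> // i; have [i2|] := leqP 2 i; last first.
    case: i => -[|[|//]] Hi _ k lt_k;
    [move: (@affine_tv0 _ _ (n + 3) _ af)|move: (@affine_tv1 _ _ (n + 3) _ af)];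
    by move=> /(_ k lt_k); rewrite ?expr0 ?expr1 => <-; congr ((tv _ _ _)`_ _);
    apply: val_inj; rewrite /= inordK.
  apply: (@eqX_comp_inj _ _ _ _ (tr M u)); rewrite ?tr0 //.
    by rewrite coef_tr //; lia.
  rewrite comp_Xn_poly; apply: (@eqX_cancel _ _ (tr M w)); first by rewrite W0 oner_neq0.
  apply: (@eqX_trans _ _ (tr M w * (tv M f i \Po tr M u))).
    apply: eqXM => //; apply: eqX_comp; rewrite ?tr0 //; apply: eqX_tv => //.
    by rewrite /M; lia.
  apply: (@eqX_trans _ _ (tv M B i)).
    by apply: (@eqX_leq _ M); [rewrite /M; lia | apply: eqX_sym].
  by rewrite tvB; apply: eqX_sym; apply: wu; rewrite -ltnS.
exists g, f; split=> //.
have qn : q n = P ord_max.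
  rewrite qE tn /Q (big_pred1 ord_max) => [|j]; last first.
    by apply/idP/eqP => [le_nj|-> //]; apply: val_inj => /=; have := ltn_ord j; lia.
  by rewrite subnn coef1 scale1r expr0 mul1r.
have in1 : (inord (n - 1) : 'I_n.+1) = (n - 1)%N :> nat by rewrite inordK //; lia.
have in2 : (inord (n - 2) : 'I_n.+1) = (n - 2)%N :> nat by rewrite inordK //; lia.
have qn1 : q (n - 1)%N = P (inord (n - 1)).
  rewrite qE tn1 /Q (bigD1 (inord (n - 1))) /=; last by rewrite in1.
  rewrite in1 subnn coef1 scale1r expr0 mul1r big1 ?addr0 // => j /andP[le_j].
  rewrite -val_eqE /= in1 => ne_j.
  by rewrite coef1 (_ : _ == _ = false) ?scale0r //; apply/eqP; move/eqP: ne_j; lia.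
(* In low degree q_(n-2) has only T_1 and T_2 as unknowns. The relation in degrees 1 and 2
   determines them, and its coefficient of X^3 becomes an expression in the coefficients of b. *)
pose T := t (n - 2)%N.
have qn2 : q (n - 2)%N =
    P (inord (n - 2)) + T`_1 *: ('X * P (inord (n - 1))) + T`_2 *: ('X^2 * P ord_max).
  rewrite qE /Q (bigD1 (inord (n - 2))) /=; last by rewrite in2.
  rewrite (bigD1 (inord (n - 1))) /=; last by rewrite -val_eqE /= in1 in2; lia.
  rewrite (big_pred1 ord_max) => [|j]; last first.
    rewrite -!val_eqE /= in1 in2; have := ltn_ord j; rewrite ltnS => le_jn.
    by apply/idP/eqP => [|->]; [move=> ?; apply: val_inj => /=|move=> /=]; lia.
  rewrite in1 in2 subnn t0 ?scale1r ?expr0 ?mul1r; last by lia.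
  have -> : (n - 1 - (n - 2) = 1)%N by lia.
  have -> : (n - (n - 2) = 2)%N by lia.
  by rewrite expr1 addrA.
have cPn k : (k < 4)%N -> (P ord_max)`_k = b (n + k)%N ord_max 0.
  by move=> lt_k; rewrite coef_P //= /M; lia.
have cPn1 k : (k < 4)%N -> (P (inord (n - 1)))`_k = b (n - 1 + k)%N (inord (n - 1)) 0.
  by move=> lt_k; rewrite coef_P //= /M in1 //; lia.
have cPn2 k : (k < 4)%N -> (P (inord (n - 2)))`_k = b (n - 2 + k)%N (inord (n - 2)) 0.
  by move=> lt_k; rewrite coef_P //= /M in2 //; lia.
have Pn0 : (P ord_max)`_0 = 1 by rewrite cPn // addn0 b_id // eqxx.
have Pn10 : (P (inord (n - 1)))`_0 = 1.
  by rewrite cPn1 // addn0 b_id ?in1 ?eqxx //; lia.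
have b_off k (i : 'I_n.+1) : (k <= n)%N -> k <> i :> nat -> b k i 0 = 0.
  by move=> le_kn /eqP/negPf ne_ki; rewrite b_id // ne_ki.
have Pn11 : (P (inord (n - 1)))`_1 = 0.
  by rewrite cPn1 // b_off ?in1 //; lia.
have Pn20 : (P (inord (n - 2)))`_0 = 1.
  by rewrite cPn2 // addn0 b_id ?in2 ?eqxx //; lia.
have Pn21 : (P (inord (n - 2)))`_1 = 0.
  by rewrite cPn2 // b_off ?in2 //; lia.
have Pn22 : (P (inord (n - 2)))`_2 = 0.
  by rewrite cPn2 // b_off ?in2 //; lia.
have {qq} qq : eqX 3 (q (n - 2)%N * q n) (q (n - 1)%N ^+ 2).
  have := qq (n - 2)%N; have -> : (n - 2).+2 = n by lia.
  have -> : (n - 2).+1 = (n - 1)%N by lia.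
  by rewrite (_ : n.+1 - (n - 2) = 3)%N; [apply | lia].
have cq2_0 : (q (n - 2)%N)`_0 = 1 by apply: q0; lia.
have cq2_1 : (q (n - 2)%N)`_1 = T`_1.
  by rewrite qn2 !coefD !coefZ coefXM coefXnM /= Pn21 Pn10 mulr0 mulr1 add0r addr0.
have cq2_2 : (q (n - 2)%N)`_2 = T`_2.
  by rewrite qn2 !coefD !coefZ coefXM coefXnM /= Pn22 Pn11 Pn0 mulr0 mulr1 !add0r.
have cq2_3 : (q (n - 2)%N)`_3 = (P (inord (n - 2)))`_3 + T`_1 * (P (inord (n - 1)))`_2
    + T`_2 * (P ord_max)`_1.
  by rewrite qn2 !coefD !coefZ coefXM coefXnM.
have coef1M (p r : {poly F}) : (p * r)`_1 = p`_0 * r`_1 + p`_1 * r`_0.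
  by rewrite coefM !big_ord_recl big_ord0 /= addr0.
have coef2M (p r : {poly F}) : (p * r)`_2 = p`_0 * r`_2 + p`_1 * r`_1 + p`_2 * r`_0.
  by rewrite coefM !big_ord_recl big_ord0 /= /bump /= addr0 !addrA.
have coef3M (p r : {poly F}) :
    (p * r)`_3 = p`_0 * r`_3 + p`_1 * r`_2 + p`_2 * r`_1 + p`_3 * r`_0.
  by rewrite coefM !big_ord_recl big_ord0 /= /bump /= addr0 !addrA.
have e1 := qq 1%N isT; have e2 := qq 2%N isT.
rewrite qn qn1 expr2 coef1M cq2_0 cq2_1 coef1M Pn0 Pn10 Pn11 in e1.
rewrite qn qn1 expr2 coef2M cq2_0 cq2_1 cq2_2 coef2M Pn0 Pn10 Pn11 in e2.
have {}e1 : T`_1 = - (P ord_max)`_1.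
  by apply/eqP; rewrite -addr_eq0; apply/eqP; move: e1; rewrite mulr1 mul1r !mul0r mulr0 addr0 addrC.
have {}e2 : T`_2 = 2%:R * (P (inord (n - 1)))`_2 - (P ord_max)`_2 + (P ord_max)`_1 ^+ 2.
  rewrite e1 in e2; move: e2 => /eqP; rewrite -subr_eq0 => /eqP e2.
  by apply/eqP; rewrite -subr_eq0; apply/eqP; rewrite -[RHS]e2; ring.
have e3 : (q (n - 2)%N * q n - q (n - 1)%N ^+ 2)`_3 =
  (P ord_max)`_3 - 2%:R * (P (inord (n - 1)))`_3 + (P (inord (n - 2)))`_3
  - 3%:R * (P ord_max)`_1 * (P ord_max)`_2
  + 3%:R * (P ord_max)`_1 * (P (inord (n - 1)))`_2 + 2%:R * (P ord_max)`_1 ^+ 3.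
  rewrite poly.coefB expr2 !coef3M qn qn1 cq2_0 cq2_1 cq2_2 cq2_3 Pn0 Pn10 Pn11 e1 e2.
  by ring.
have kE : (q (n - 2)%N * q n - q (n - 1)%N ^+ 2)`_3 = f (n + 3)%N ord_max 0.
  (* both sides are compared with [Q_(n-2) (Q_n - w v^n)], where [u = X v] *)
  set c := f _ _ _.
  have eqv : eqX 4 (q (n - 2)%N * v) (q (n - 1)%N).
    have := chain (n - 2)%N; have -> : (n - 2).+1 = (n - 1)%N by lia.
    by rewrite (_ : n + 2 - (n - 2) = 4)%N; [apply; lia | lia].
  have wv : eqX 4 (tr M w * v ^+ (n - 1)) (q (n - 1)%N).
    apply/(@eqX_mulXn _ (n - 1)); rewrite mulrCA -exprMn -def_u.
    apply: (@eqX_leq _ (n + 3)); [lia | apply: wu; lia].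
  have last : eqX 4 (q n) (tr M w * v ^+ n + c *: 'X^3).
    apply/(@eqX_mulXn _ n); apply: (@eqX_leq _ M); first by rewrite /M; lia.
    apply: (@eqX_trans _ _ (tr M w * (tv M f ord_max \Po tr M u))).
      by rewrite -[X in 'X^X]/(val (ord_max : 'I_n.+1)) -tvB.
    apply: (@eqX_trans _ _ (tr M w * (('X^n + c *: 'X^(n + 3)) \Po tr M u))).
      apply: eqXM => //; apply: eqX_comp; rewrite ?tr0 // => k lt_k.
      have [lt_k3|ge_k3] := ltnP k (n + 3).
        rewrite coefD coefZ !coefXn (ltn_eqF lt_k3) mulr0 addr0 -coefXn.
        by rewrite -(proj2 nf ord_max k lt_k3) !coef_tv.
      have -> : k = (n + 3)%N by move: lt_k; rewrite /M; lia.
      rewrite coef_tv; last by rewrite /M; lia.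
      rewrite coefD coefZ !coefXn eqxx mulr1 (_ : _ == _ = false) ?add0r //.
      by apply/eqP; lia.
    rewrite comp_polyD comp_polyZ !comp_Xn_poly def_u !exprMn mulrDr mulrDr.
    apply: eqXD; first by rewrite mulrCA.
    rewrite -!scalerAr; apply: eqXZ; rewrite mulrCA exprD -mulrA.
    apply: (@eqX_leq _ (n + (3 + 1))); first by rewrite /M; lia.
    rewrite -[X in eqX _ _ X]mulr1 -mulrA; apply/eqX_mulXn/eqX_mulXn => -[|//] _.
    by rewrite coef0M coef0X W0 v0 expr1n mulr1 coef1.
  have : eqX 4 (q (n - 2)%N * q n) (q (n - 1)%N ^+ 2 + c *: ('X^3 * q (n - 2)%N)).
    apply: (eqX_trans (eqXM (@eqX_refl _ _ _) last)); rewrite mulrDr; apply: eqXD.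
      have -> : v ^+ n = v * v ^+ (n - 1) by rewrite -exprS; congr (_ ^+ _); lia.
      by rewrite [tr M w * _]mulrCA [q _ * _]mulrA expr2; apply: eqXM.
    by rewrite -scalerAr; apply: eqXZ; rewrite mulrC.
  move=> /(_ 3%N isT); rewrite coefD coefZ coefXnM /= cq2_0 mulr1 poly.coefB => ->.
  by rewrite addrC addKr.
rewrite -kE e3 !cPn // !cPn1 // cPn2 //.
have -> : (n - 1 + 2 = n + 1)%N by lia.
have -> : (n - 1 + 3 = n + 2)%N by lia.
have -> : (n - 2 + 3 = n + 1)%N by lia.
by [].
Qed.

End Reduction.

End Existence.

(** * Normal forms of non-inflexional arcs and their two invariants *)

Section Slice.
Variables (F : fieldType) (n : nat).
Hypothesis n2 : (2 <= n)%N.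
Implicit Types (a b f : vseries F n) (g : 'M[F]_n.+1).

Lemma jetmx_col a (k : 'I_n.+1) : a k = col k (jetmx a).
Proof. by apply/colP => i; rewrite !mxE. Qed.

(** Applying the inverse of (a_0, ..., a_n) reduces to [normal_form_id]; the coefficients that occur
    are then Cramer quotients, and the formula, of degree 3 in them, is cleared by the cube of the
    determinant. *)
Lemma normal_form a : \det (jetmx a) != 0 -> exists g f,
  [/\ g \in unitmx, arc (gmul g a) f, normal f &
      \det (jetmx a) ^+ 3 * f (n + 3)%N ord_max 0 = monge_poly a].
Proof.
move=> W0; set W := \det _; have Au : jetmx a \in unitmx by rewrite unitmxE unitfE.
pose b := gmul (invmx (jetmx a)) a.
have b_id k (i : 'I_n.+1) : (k <= n)%N -> b k i 0 = (k == i)%:R.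
  rewrite -ltnS => lt_kn; rewrite /b /gmul -[k]/(val (Ordinal lt_kn)) jetmx_col.
  by rewrite colE mulmxA mulVmx // mul1mx mxE eqxx andbT -val_eqE eq_sym.
have [g [f [gu bf nf ef]]] := normal_form_id n2 b_id.
have cr k i : cramer a k i = W * b (n + k)%N (inord i) 0.
  rewrite /b /gmul /invmx Au -scalemxAl mxE mulrA mulfV ?mul1r //.
exists (g *m invmx (jetmx a)), f; split=> //.
- by rewrite unitmx_mul gu unitmx_inv.
- by rewrite -gmulA.
have inn : inord n = ord_max :> 'I_n.+1 by apply: val_inj; rewrite /= inordK.
by rewrite /monge_poly !cr -/W ef inn; ring.
Qed.

(* the invariants [c_n] and [e] of the normal form [f] *)
Definition kap f : F := f (n + 3)%N ord_max 0.
Definition eps f : F :=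
  if n == 2%N then f 6 ord_max 0 else f (n + 3)%N (inord (n - 1)) 0.

Lemma normal_upto f (i : 'I_n.+1) (p : {poly F}) : normal f ->
  (forall k, (k < n + 3)%N -> p`_k = ('X^i)`_k) -> p`_(n + 3) = f (n + 3)%N i 0 ->
  eq_series_upto (n + 4) (fun k => f k i 0) p.
Proof.
move=> nf e1 e2 k; rewrite addnS ltnS leq_eqVlt => /orP[/eqP->|lt_k].
  by rewrite e2.
by rewrite e1 // -(proj2 nf i k lt_k) coef_tv.
Qed.

(** Beyond normality the slice fixes two coefficients, 1 in f_n and 0 in f_(n-1). When n = 2,
    f_(n-1) is the parameter itself, and the second condition bears on t^6 in f_2. *)
Lemma slice_formP f : slice_form f <-> [/\ normal f, kap f = 1 & eps f = 0].
Proof.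
have inn : inord n = ord_max :> 'I_n.+1 by apply: val_inj; rewrite /= inordK.
have in1 : (inord (n - 1) : 'I_n.+1) = (n - 1)%N :> nat by rewrite inordK //; lia.
split=> [[f0 f1]|[nf kf ef]].
  have f01 k (i : 'I_n.+1) : (i < 2)%N -> f k i 0 = ('X^i : {poly F})`_k.
    by case: i => -[|[|//]] Hi _; [rewrite expr0 -f0|rewrite expr1 -f1];
    rewrite /coord; congr (f k _ 0); apply: val_inj; rewrite /= inordK.
  rewrite /kap /eps; case: eqP => [nn2 f2|nn2 [fi fn1 fn]].
    have inn2 : inord 2 = ord_max :> 'I_n.+1 by rewrite -inn nn2.
    rewrite /coord inn2 in f2; split.
    - split=> // i k lt_k; rewrite coef_tv //.
      have [/f01 //|le2i] := ltnP i 2.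
      have -> : i = ord_max by apply: val_inj; have := ltn_ord i => /=; lia.
      rewrite f2 ?coefD; last by lia.
      by rewrite /= nn2 !coefXn (_ : (k == 5) = false) ?addr0 //; apply/eqP; lia.
    - by rewrite f2 nn2 // coefD !coefXn add0r.
    - by rewrite f2 // coefD !coefXn addr0.
  rewrite /coord inn in fi fn1 fn; split.
  - split=> // i k lt_k; rewrite coef_tv //.
    have [/f01 //|le2i] := ltnP i 2.
    have [le_i|lt_i] := leqP i (n - 2).
      by rewrite -(fi i) ?le2i // inord_val.
    have [def_i|def_i] : i = (n - 1)%N :> nat \/ i = n :> nat.
    + by have := ltn_ord i; lia.
    + have -> : i = inord (n - 1) by apply: val_inj; rewrite /= in1.
      by rewrite fn1 ?in1 //; lia.
    + have -> : i = ord_max by apply: val_inj.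
      rewrite fn ?coefD; last by lia.
      by rewrite !coefXn (_ : (k == n + 3) = false)%N ?addr0 //; apply/eqP; lia.
  - rewrite fn ?coefD ?coefXn ?eqxx; last by lia.
    by rewrite (_ : (_ == n) = false) ?add0r //; apply/eqP; lia.
  - rewrite fn1 ?coefXn; last by lia.
    by rewrite (_ : _ == _ = false) //; apply/eqP; lia.
have [[f0 f1] fi] := nf; split=> //; move: ef; rewrite /eps; case: eqP => [nn2 ef|nn2 ef].
  have inn2 : inord 2 = ord_max :> 'I_n.+1 by rewrite -inn nn2.
  move=> k; rewrite ltnS leq_eqVlt /coord inn2 => /orP[/eqP->|lt_k].
    by rewrite ef coefD !coefXn addr0.
  apply: (normal_upto nf); last by lia.
    move=> j lt_j; rewrite /= nn2 coefD !coefXn (_ : (j == 5) = false) ?addr0 //.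
    by apply/eqP; lia.
  by rewrite -[RHS]/(kap f) kf nn2 coefD !coefXn add0r.
rewrite /coord; split.
- move=> i /andP[le2i le_i] k lt_k; have := fi (inord i) k lt_k.
  by rewrite coef_tv // inordK //; lia.
- by apply: (normal_upto nf) => [k _|]; rewrite ?in1 // ef coefXn (_ : _ == _ = false) //; apply/eqP; lia.
rewrite inn; apply: (normal_upto nf) => [k lt_k|].
  by rewrite coefD !coefXn (ltn_eqF lt_k) addr0.
rewrite -[RHS]/(kap f) kf coefD !coefXn eqxx (_ : (_ == n) = false) ?add0r //.
by apply/eqP; lia.
Qed.

Lemma sympow_trig (x y z : F) (i j : 'I_n.+1) : (j <= i)%N ->
  sympow n (tri x y z) i j = if i == j then x ^+ (n - i) * z ^+ i else 0.
Proof.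
move=> le_ji; rewrite sympow_tri exprMn mulrA -polyC_exp mulrC coefXnM.
rewrite -val_eqE /= eq_sym; case: ltngtP le_ji => // -> _.
by rewrite subnn coef0M coef0X coefD !coefC coefMX /= addr0.
Qed.

Lemma sympow_unit (x y z : F) : x != 0 -> z != 0 -> sympow n (tri x y z) \in unitmx.
Proof.
move=> x0 z0; rewrite unitmxE -det_tr det_trig; last first.
  apply/is_trig_mxP => i j lt_ij; rewrite mxE sympow_trig ?(ltnW lt_ij) //.
  by rewrite -val_eqE gtn_eqF.
rewrite unitfE; apply/prodf_neq0 => i _; rewrite mxE sympow_trig // eqxx.
by rewrite mulf_neq0 // expf_neq0.
Qed.

Lemma transfer_exists f (x y z : F) : x != 0 -> z != 0 -> normal f ->
  exists2 f', arc (gmul (sympow n (tri x y z)) f) f' & affine f'.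
Proof.
move=> x0 z0 nf; set S := sympow n _.
have cS k i : (k < n + 3)%N -> gmul S f k i 0 = (rowp S i)`_k.
  by move=> lt_k; rewrite -(tv_gmul_normal S i nf) // coef_tv.
have L0 k : ((x%:P + y%:P * 'X) ^+ k)`_0 = x ^+ k.
  by rewrite coef0X coefD coefC coefMX /= addr0.
have i0 : (inord 0 : 'I_n.+1) = 0%N :> nat by rewrite inordK.
have i1 : (inord 1 : 'I_n.+1) = 1%N :> nat by rewrite inordK //; lia.
apply: affine_exists; rewrite cS ?rowp_sympow_tri ?i0 ?i1 ?expr1; try lia.
- by rewrite expr0 mulr1 L0 expf_neq0.
- by rewrite mulrA coefMX.
- by rewrite mulrA coefMX /= coef0M L0 coefC mulf_neq0 // expf_neq0.
Qed.

End Slice.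

(** The matrix is upper triangular: its last row has the single entry z^n, and the row above has x
    z^(n-1) and y z^(n-1). Cancelling these powers of z in [transfer] gives both laws. *)
Lemma transfer_invariants (F : fieldType) n (f f' : vseries F n) (x y z : F) :
  (2 <= n)%N -> x != 0 -> z != 0 -> normal f -> affine f' ->
  arc f' (gmul (sympow n (tri x y z)) f) ->
  [/\ normal f', z ^+ 3 * kap f' = x ^+ 3 * kap f &
      z ^+ 4 * eps f' = x ^+ 3 * (x * eps f + y * kap f)].
Proof.
move=> n2 x0 z0 nf af ff'; have [nf' tr_f] := transfer n2 x0 z0 nf af ff'.
have zn0 k : z ^+ k != 0 by rewrite expf_neq0.
split=> //.
  apply: (@mulfI _ (z ^+ n)) => //; rewrite mulrA -exprD tr_f //.
  rewrite (bigD1 ord_max) //= big1 ?addr0.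
    by rewrite sympow_trig // eqxx subnn expr0 mul1r /kap mulrCA.
  move=> j ne_j; rewrite sympow_trig ?[_ == j]eq_sym ?(negPf ne_j) ?mul0r //.
  by rewrite -ltnS.
have [nn2|nn2] := eqVneq n 2%N.
  by subst n; apply: transfer_conic.
rewrite /eps (negPf nn2) -/(kap f).
have lt1 : (n - 1 < n.+1)%N by lia.
have e1 : inord (n - 1) = Ordinal lt1 by apply: val_inj; rewrite /= inordK.
rewrite e1; apply: (@mulfI _ (z ^+ (n - 1))) => //; rewrite mulrA -exprD.
have -> : (n - 1 + 4 = n + 3)%N by lia.
rewrite tr_f /=; last by lia.
rewrite (bigD1 (Ordinal lt1)) //= (bigD1 ord_max) /=; last first.
  by rewrite -val_eqE /=; lia.
rewrite big1 ?addr0 => [|j /andP[ne1]]; last first.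
  rewrite -val_eqE /= => ne2; rewrite sympow_trig ?[_ == j]eq_sym ?(negPf ne1) ?mul0r //.
  by move: ne1; rewrite -val_eqE /=; have := ltn_ord j; lia.
rewrite sympow_trig // eqxx /= sympow_tri /=.
have -> : (n - (n - 1) = 1)%N by lia.
rewrite !expr1 exprMn -polyC_exp mulrCA coefCM.
have -> : ((x%:P + y%:P * 'X) * 'X^(n - 1))`_n = y.
  rewrite mulrC coefXnM (_ : (n < n - 1)%N = false); last by lia.
  have -> : (n - (n - 1) = 1)%N by lia.
  by rewrite coefD coefC coefMX coefC add0r.
by rewrite /kap; ring.
Qed.

(** * Orbits *)

Section Orbits.
Variables (F : closedFieldType) (n : nat).
Hypothesis n2 : (2 <= n)%N.
Implicit Types (a b f : vseries F n) (g : 'M[F]_n.+1) (X : set (vseries F n)).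

Lemma closed_root k (c : F) : (0 < k)%N -> exists x, x ^+ k = c.
Proof.
move=> k0; have /closed_rootP[x] : size ('X^k - c%:P : {poly F}) != 1.
  by rewrite size_XnsubC // eqSS -lt0n.
by rewrite rootE !hornerE subr_eq0 => /eqP; exists x.
Qed.

Definition dg (l : F) : 'M[F]_n.+1 := diag_mx (\row_i l ^+ i).

Lemma dgM k l : dg k *m dg l = dg (k * l).
Proof.
rewrite /dg mulmx_diag; congr diag_mx; apply/rowP => i.
by rewrite !mxE exprMn.
Qed.

Lemma dg1 : dg 1 = 1%:M.
Proof.
by apply/matrixP => i j; rewrite !mxE expr1n.
Qed.

Lemma sympow_diag (x z : F) : x != 0 -> sympow n (tri x 0 z) = x ^+ n *: dg (z / x).
Proof.
move=> x0; apply/matrixP => i j; rewrite sympow_tri polyC0 mul0r addr0.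
rewrite exprMn -!polyC_exp mulrA -polyCM coefCM coefXn !mxE -val_eqE /= eq_sym.
have le_in : (i <= n)%N by rewrite -ltnS.
case: eqP => _; rewrite ?mulr0n ?mulr0 // mulr1n mulr1 expr_div_n mulrCA mulrC.
by congr (_ * _); rewrite expfB_cond // (negPf x0).
Qed.

Lemma dg_sympow l : dg l = sympow n (tri 1 0 l).
Proof. by rewrite sympow_diag ?oner_neq0 // expr1n scale1r divr1. Qed.

Lemma dg_unit l : l != 0 -> dg l \in unitmx.
Proof. by move=> l0; rewrite dg_sympow sympow_unit ?oner_neq0. Qed.

Lemma cube1_neq0 (l : F) : l ^+ 3 = 1 -> l != 0.
Proof. by move=> l3; have := oner_neq0 F; rewrite -l3 expf_eq0. Qed.

(** mu_3 described by all cube roots of unity, over any closed field; [mu3E] compares it with the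
    group generated by e^(i pi/3). *)
Definition cubic_group : set (set 'M[F]_n.+1) :=
  [set pgl (dg l) | l in [set l : F | l ^+ 3 = 1]].

Lemma slice_exists f : normal f -> kap f != 0 ->
  exists g f', [/\ g \in unitmx, arc (gmul g f) f' & slice_form f'].
Proof.
(* With x = 1 the laws are z^3 c' = c and z^4 e' = e + y c: a cube root z of c gives c' = 1, and y =
   - e / c gives e' = 0. *)
move=> nf k0; have [z z3] := @closed_root 3 (kap f) isT.
have z0 : z != 0 by apply: contraNneq k0 => z0; rewrite -z3 z0 expr0n.
pose y := - eps f / kap f; have x0 := oner_neq0 F.
have [f' ff' af'] := transfer_exists n2 y x0 z0 nf.
exists (sympow n (tri 1 y z)), f'; split=> //; first exact: sympow_unit.
have [nf' k' e'] := transfer_invariants n2 x0 z0 nf af' (arc_sym ff').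
apply/(slice_formP n2); split=> //.
  by apply: (@mulfI _ (z ^+ 3)); rewrite ?expf_neq0 // k' expr1n mul1r mulr1.
apply: (@mulfI _ (z ^+ 4)); rewrite ?expf_neq0 // e' expr1n !mul1r mulr0.
by rewrite /y mulfVK // subrr.
Qed.

Lemma slice_unique f f' g : slice_form f -> slice_form f' -> g \in unitmx ->
  arc f' (gmul g f) ->
  exists s l, [/\ s != 0, l ^+ 3 = 1 & g = s *: dg l].
Proof.
move=> /(slice_formP n2)[nf kf ef] /(slice_formP n2)[nf' kf' ef'] gu ff'.
have [x [y [z [s [x0 z0 s0 def_g]]]]] := normal_unique (ltnW n2) nf nf' ff'.
rewrite def_g in ff' *.
have {}ff' : arc f' (gmul (sympow n (tri x y z)) f).
  apply: arc_trans ff' _; apply: arc_sym; rewrite -(@arc_gmul_scale _ _ s) //.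
  exact: arc_refl.
have [_] := transfer_invariants n2 x0 z0 nf (proj1 nf') ff'.
(* With c = c' = 1 and e = e' = 0 the laws become z^3 = x^3 and x^3 y = 0. *)
rewrite kf kf' ef ef' !mulr1 !mulr0 add0r => zx /eqP.
rewrite eq_sym mulf_eq0 expf_eq0 (negPf x0) /= => /eqP ->.
exists (s * x ^+ n), (z / x); rewrite sympow_diag // scalerA; split=> //.
  by rewrite mulf_neq0 // expf_neq0.
by rewrite expr_div_n zx divff // expf_neq0.
Qed.

Lemma slice_stable f l : slice_form f -> l ^+ 3 = 1 ->
  exists2 f', slice_form f' & arc (gmul (dg l) f) f'.
Proof.
move=> /(slice_formP n2)[nf kf ef] l3; have l0 := cube1_neq0 l3.
have x0 := oner_neq0 F.
have [f' ff' af'] := transfer_exists n2 0 x0 l0 nf.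
exists f'; last by rewrite dg_sympow.
have [nf' k' e'] := transfer_invariants n2 x0 l0 nf af' (arc_sym ff').
apply/(slice_formP n2); split=> //.
  by move: k'; rewrite l3 expr1n kf !mul1r.
apply: (@mulfI _ (l ^+ 4)); rewrite ?expf_neq0 //.
by rewrite e' ef mul0r mulr0 addr0 !mulr0.
Qed.

Lemma cubic_group_stable K X : cubic_group K -> slice_mu3 X -> slice_mu3 (pgl_act K X).
Proof.
move=> [l l3 <-] [f sf <-]; have [f' sf' ff'] := slice_stable sf l3.
exists f' => //; rewrite pgl_act_arc ?dg_unit ?(cube1_neq0 l3) //.
exact/esym/arc_eq.
Qed.

Lemma pgl_mulE g h : g \in unitmx -> h \in unitmx ->
  pgl_mul (pgl g) (pgl h) = pgl (g *m h).
Proof.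
move=> gu hu; apply/seteqP; split=> [_ [_ [c c0 <-] [_ [d d0 <-] <-]]|_ [c c0 <-]].
  exists (c * d); first by rewrite /= mulf_neq0.
  by rewrite -scalemxAl -scalemxAr scalerA.
exists (c *: g); first by exists c.
exists (1 *: h); first by exists 1 => //; apply: oner_neq0.
by rewrite scale1r scalemxAl.
Qed.

Lemma pgl_scale (c : F) g : c != 0 -> pgl (c *: g) = pgl g.
Proof.
move=> c0; apply/seteqP; split=> _ [d d0 <-].
  by exists (d * c); rewrite ?scalerA //= mulf_neq0.
by exists (d / c); rewrite ?scalerA ?mulfVK //= mulf_neq0 ?invr_eq0.
Qed.

Lemma cubic_group_subgroup : pgl_subgroup cubic_group.
Proof.
split.
- by move=> _ [l l3 <-]; exists (dg l) => //; apply: dg_unit; apply: cube1_neq0.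
- by exists 1; rewrite /= ?expr1n // dg1.
- move=> _ _ [k k3 <-] [l l3 <-]; exists (k * l); first by rewrite /= exprMn k3 l3 mulr1.
  by rewrite pgl_mulE ?dgM // dg_unit ?cube1_neq0.
move=> g gu [l l3 e]; have l0 := cube1_neq0 l3.
have [c c0 <-] : pgl (dg l) g by rewrite e; exists 1; [apply: oner_neq0 | rewrite scale1r].
exists l^-1; first by rewrite /= exprVn l3 invr1.
rewrite invmxZ ?unitfE //; last by rewrite unitmxZ ?unitfE ?dg_unit.
rewrite pgl_scale ?invr_eq0 //; congr pgl.
apply: (can_inj (mulKmx (dg_unit l0))); rewrite dgM mulfV // dg1 mulmxV //.
exact: dg_unit.
Qed.

Lemma meets_cubic_group a g f : g \in unitmx -> arc (gmul g a) f -> normal f ->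
  kap f != 0 -> meets_along_orbit (arc a) (@slice_mu3 F n) cubic_group.
Proof.
move=> gu gf nf k0; have [h [f0 [hu hf sf0]]] := slice_exists nf k0.
have uu : h *m g \in unitmx by rewrite unitmx_mul hu gu.
have {h g uu gu hu gf nf k0 hf} [g gu gf] : exists2 g, g \in unitmx & arc (gmul g a) f0.
  by exists (h *m g) => //; rewrite -gmulA; apply: arc_trans hf; apply: gmul_arc.
exists (arc f0); first by exists f0.
apply/seteqP; split=> [_ [[g1 /= g1d <-] [f1 sf1 ef1]]|_ [_ [l l3 <-] <-]].
  have g1u : g1 \in unitmx by rewrite unitmxE g1d unitr1.
  (* g_1 g^(-1) carries the point f_0 of the slice to the other one, so [slice_unique] applies to
     it. *)
  have ef0 : arc (gmul (g1 *m invmx g) f0) = arc (gmul g1 a).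
    apply: arc_eq; rewrite -[X in arc _ X]/(gmul g1 a).
    have := gmul_arc (g1 *m invmx g) (arc_sym gf).
    by rewrite gmulA mulmxKV.
  rewrite act_arc // in ef1 *.
  have [s [l [s0 l3 def_g]]] : exists s l,
      [/\ s != 0, l ^+ 3 = 1 & g1 *m invmx g = s *: dg l].
    apply: (slice_unique sf0 sf1); first by rewrite unitmx_mul g1u unitmx_inv.
    by rewrite ef1 -ef0; apply: arc_refl.
  exists (pgl (dg l)); first by exists l.
  rewrite pgl_act_arc ?dg_unit ?cube1_neq0 // -ef0 def_g.
  by rewrite arc_gmul_scale.
have l0 := cube1_neq0 l3.
split; last by apply: cubic_group_stable; [exists l | exists f0].
have du : \det (dg l *m g) != 0.
  by rewrite -unitfE -unitmxE unitmx_mul dg_unit.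
(* Scaling by an (n+1)-th root of the inverse determinant lifts the element of PGL to SL. *)
have [d dn] := @closed_root n.+1 ((\det (dg l *m g))^-1) isT.
have d0 : d != 0.
  by apply: contraNneq du => d0; rewrite -invr_eq0 -dn d0 expr0n.
exists (d *: (dg l *m g)); first by rewrite /= detZ dn mulVf.
rewrite act_arc ?unitmxZ ?unitfE ?unitmx_mul ?dg_unit // arc_gmul_scale //.
rewrite pgl_act_arc ?dg_unit // -gmulA.
exact/arc_eq/gmul_arc.
Qed.

(** p w vanishes at every point of an infinite field, hence is zero. *)
Lemma poly_eq0_off (p w : {poly F}) : w != 0 ->
  (forall x, w.[x] != 0 -> p.[x] = 0) -> p = 0.
Proof.
move=> w0 pw; apply/eqP; apply: contraNT w0 => p0.
have : p * w = 0.
  apply/eqP/negPn/negP => /closed_nonrootP[x] /negP; apply.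
  rewrite rootE hornerM; have [->|/pw ->] := eqVneq w.[x] 0; first by rewrite mulr0.
  by rewrite mul0r.
by move/eqP; rewrite mulf_eq0 (negPf p0).
Qed.

Lemma horner_mmap m (h : 'I_m -> {poly F}) (p : {mpoly F[m]}) x :
  (mmap (@polyC F) h p).[x] = p.@[fun i => (h i).[x]].
Proof.
rewrite mevalE /mmap horner_sum; apply: eq_bigr => k _.
rewrite hornerM hornerC /mmap1 horner_prod; congr (_ * _).
by apply: eq_bigr => i _; rewrite horner_exp.
Qed.

Lemma eqX_mmap m k (h h' : 'I_m -> {poly F}) (p : {mpoly F[m]}) :
  (forall i, eqX k (h i) (h' i)) ->
  eqX k (mmap (@polyC F) h p) (mmap (@polyC F) h' p).
Proof.
move=> e; apply: eqX_sum => l _; apply: eqXM => //.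
by apply: eqX_prod => i _; apply: eqXX.
Qed.

(* The pull-back of an equation of the curve by [t |-> w nu(1, u)] vanishes at
   every [t] with [w(t) <> 0], hence identically. *)
Lemma normal_contains a g f : g \in unitmx -> arc (gmul g a) f -> normal f ->
  contains_subscheme (n + 3) [set invmx g *m v | v in @standard_nrc F n] (arc a).
Proof.
move=> gu gf nf c d p ac _ p0 k lt_k.
have fc : arc f (gmul g c).
  by apply: arc_trans (arc_sym gf) _; apply: gmul_arc.
have /arcP[w [u [w0 u0 u1 e]]] := fc.
pose W := tr (n + 3) w; pose U := tr (n + 3) u.
pose h (i : 'I_n.+1) := \sum_j invmx g i j *: (W * U ^+ j).
have -> : (mmap (@polyC F) (fun i => \poly_(l < n + 3) c l i 0) p)`_k =
    (mmap (@polyC F) h p)`_k.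
  move: k lt_k; apply: eqX_mmap => i; rewrite -[X in eqX _ X _]/(tv (n + 3) c i).
  have -> : c = gmul (invmx g) (gmul g c) by rewrite gmulA mulVmx ?gmul1.
  rewrite tv_gmul; apply: eqX_sum => j _; apply: eqXZ.
  apply: eqX_trans (e _ _) _; apply: eqXM => //.
  apply: (@eqX_trans _ _ ('X^j \Po U)); last by rewrite comp_Xn_poly.
  by apply: eqX_comp; rewrite ?tr0 //; apply: (proj2 nf).
rewrite (_ : mmap _ h p = 0) ?coef0 //; apply: (@poly_eq0_off _ W).
  apply: contraNneq w0 => W0; rewrite -(@coef_tr _ (n + 3)) -/W ?W0 ?coef0 //.
  by rewrite addnS.
move=> x Wx; rewrite horner_mmap.
have := p0 (invmx g *m (W.[x] *: veronese n 1 U.[x])) => <-.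
  apply: meval_eq => i; rewrite mxE horner_sum; apply: eq_bigr => j _.
  by rewrite !hornerE !mxE expr1n mul1r [RHS]mulrA.
exists (W.[x] *: veronese n 1 U.[x]) => //.
by exists W.[x], 1, U.[x]; rewrite oner_neq0.
Qed.

(** The osculating curve is the image of the standard one under the inverse of the matrix g that
    puts the arc in normal form. By contraposition, an arc outside the Monge hypersurface has c_n
    nonzero. *)
Lemma normal_monge a g f : noninflexional_arcs (arc a) -> g \in unitmx ->
  arc (gmul g a) f -> normal f -> kap f = 0 -> monge_hypersurface (arc a).
Proof.
move=> nia gu gf nf k0; split=> //.
exists [set invmx g *m v | v in @standard_nrc F n], g, f, (fun i => f (n + 3)%N (inord i) 0).
split.
- split; last exact: normal_contains gf nf.
  by exists (invmx g); rewrite ?unitmx_inv.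
- split=> //; apply/seteqP; split=> [_ [_ [v sv <-] <-]|v sv].
    by rewrite mulKVmx.
  by exists (invmx g *m v); [exists v | rewrite mulKVmx].
- by rewrite act_arc.
- have [[f0 f1] fi] := nf; split=> // i /andP[le2i le_in].
  apply: (normal_upto nf) => [k lt_k|].
    by rewrite coefD coefZ !coefXn (ltn_eqF lt_k) mulr0 addr0 inordK.
  rewrite coefD coefZ !coefXn eqxx mulr1 (_ : _ == _ = false) ?add0r //.
  by apply/eqP; lia.
- by rewrite -[RHS]k0 /kap; congr (f _ _ _); apply: val_inj; rewrite /= inordK.
Qed.

End Orbits.

(** * Zariski topology *)

Section JetPolynomials.
Variables (F : fieldType) (n r : nat).
Implicit Types (a b f : vseries F n) (X : set (vseries F n)).
Implicit Types (c d : vseries F n -> F) (G H : vseries F n -> {poly F}).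

(** The regular functions on the affine space of parametrised r-jets, viewed as functions of the
    parametrised arc. *)
Definition jetpoly c :=
  exists P : {mpoly F[n.+1 * r.+1]}, forall a, c a = P.@[mxvec (jet r a) 0].

Lemma jetpoly_ext c d : c =1 d -> jetpoly c -> jetpoly d.
Proof. by move=> cd [P e]; exists P => a; rewrite -cd. Qed.

Lemma jetpoly_cst x : jetpoly (fun=> x).
Proof. by exists x%:MP => a; rewrite mevalC. Qed.

Lemma jetpoly_coef k i : (k <= r)%N -> jetpoly (fun a => a k i 0).
Proof.
move=> le_kr; exists 'X_(mxvec_index i (inord k : 'I_r.+1)) => a.
by rewrite mevalXU mxvecE mxE inordK.
Qed.

Lemma jetpolyD c d : jetpoly c -> jetpoly d -> jetpoly (fun a => c a + d a).
Proof. by move=> [P e] [Q e']; exists (P + Q) => a; rewrite mevalD e e'. Qed.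

Lemma jetpolyM c d : jetpoly c -> jetpoly d -> jetpoly (fun a => c a * d a).
Proof. by move=> [P e] [Q e']; exists (P * Q) => a; rewrite mevalM e e'. Qed.

Lemma jetpolyN c : jetpoly c -> jetpoly (fun a => - c a).
Proof. by move=> [P e]; exists (- P) => a; rewrite mevalN e. Qed.

Lemma jetpolyB c d : jetpoly c -> jetpoly d -> jetpoly (fun a => c a - d a).
Proof. by move=> pc pd; apply: jetpolyD => //; apply: jetpolyN. Qed.

Lemma jetpolyX c k : jetpoly c -> jetpoly (fun a => c a ^+ k).
Proof.
move=> pc; elim: k => [|k IH]; first exact: (jetpoly_cst 1).
by apply: jetpoly_ext (jetpolyM pc IH) => a; rewrite exprS.
Qed.

Lemma jetpoly_sum (I : Type) (s : seq I) (P : pred I) (C : I -> vseries F n -> F) :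
  (forall i, jetpoly (C i)) -> jetpoly (fun a => \sum_(i <- s | P i) C i a).
Proof.
move=> pC; elim: s => [|i s IH].
  by apply: jetpoly_ext (jetpoly_cst 0) => a; rewrite big_nil.
case Pi: (P i); last by apply: jetpoly_ext IH => a; rewrite big_cons Pi.
by apply: jetpoly_ext (jetpolyD (pC i) IH) => a; rewrite big_cons Pi.
Qed.

Lemma jetpoly_prod (I : Type) (s : seq I) (P : pred I) (C : I -> vseries F n -> F) :
  (forall i, jetpoly (C i)) -> jetpoly (fun a => \prod_(i <- s | P i) C i a).
Proof.
move=> pC; elim: s => [|i s IH].
  by apply: jetpoly_ext (jetpoly_cst 1) => a; rewrite big_nil.
case Pi: (P i); last by apply: jetpoly_ext IH => a; rewrite big_cons Pi.
by apply: jetpoly_ext (jetpolyM (pC i) IH) => a; rewrite big_cons Pi.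
Qed.

Lemma jetpoly_det m (A : vseries F n -> 'M[F]_m) :
  (forall i j, jetpoly (fun a => A a i j)) -> jetpoly (fun a => \det (A a)).
Proof.
move=> pA; apply: jetpoly_sum => s; apply: jetpolyM; first exact: jetpoly_cst.
by apply: jetpoly_prod.
Qed.

Lemma jetpoly_adj m (A : vseries F n -> 'M[F]_m) i j :
  (forall i j, jetpoly (fun a => A a i j)) -> jetpoly (fun a => (\adj (A a)) i j).
Proof.
move=> pA; apply: (@jetpoly_ext (fun a => cofactor (A a) j i)).
  by move=> a; rewrite mxE.
apply: jetpolyM; first exact: jetpoly_cst.
apply: jetpoly_det => k l; apply: jetpoly_ext (pA (lift j k) (lift i l)) => a.
by rewrite !mxE.
Qed.

Definition jetpolys G := forall k, jetpoly (fun a => (G a)`_k).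

Lemma jetpolys_tv M i : (M <= r.+1)%N -> jetpolys (fun a => tv M a i).
Proof.
move=> le_M k; have [lt_k|le_k] := ltnP k M.
  apply: jetpoly_ext (jetpoly_coef i (_ : (k <= r)%N)) => [a|]; last by lia.
  by rewrite coef_tv.
by apply: jetpoly_ext (jetpoly_cst 0) => a; rewrite coef_poly ltnNge le_k.
Qed.

Lemma jetpolysM G H : jetpolys G -> jetpolys H -> jetpolys (fun a => G a * H a).
Proof.
move=> pG pH k.
apply: (@jetpoly_ext (fun a => \sum_(i < k.+1) (G a)`_i * (H a)`_(k - i))).
  by move=> a; rewrite coefM.
by apply: jetpoly_sum => i; apply: jetpolyM.
Qed.

Lemma jetpolysX G m : jetpolys G -> jetpolys (fun a => G a ^+ m).
Proof.
move=> pG; elim: m => [|m IH] k.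
  by apply: jetpoly_ext (jetpoly_cst (1 : {poly F})`_k) => a.
by apply: jetpoly_ext (jetpolysM pG IH k) => a; rewrite exprS.
Qed.

Lemma jetpolysD G H : jetpolys G -> jetpolys H -> jetpolys (fun a => G a + H a).
Proof.
by move=> pG pH k; apply: jetpoly_ext (jetpolyD (pG k) (pH k)) => a; rewrite coefD.
Qed.

Lemma jetpolysB G H : jetpolys G -> jetpolys H -> jetpolys (fun a => G a - H a).
Proof.
by move=> pG pH k; apply: jetpoly_ext (jetpolyB (pG k) (pH k)) => a; rewrite poly.coefB.
Qed.

Lemma jet_surj (J : 'M[F]_(n.+1, r.+1)) : exists a, jet r a = J.
Proof.
exists (fun k => col (inord k) J); apply/matrixP => i k.
by rewrite !mxE inord_val.
Qed.

(** Q is a union of principal open sets c != 0. Being stable under reparametrisation and depending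
    on the r-jet only, it comes from an open set of truncated arcs at the single level r. *)
Lemma open_arcs_jetpoly (S : set (vseries F n -> F)) (Q : set (vseries F n)) :
  (forall a, Q a <-> exists2 c, S c & c a != 0) -> (forall c, S c -> jetpoly c) ->
  (forall a, Q a -> smooth_param a) -> (forall a b, arc a b -> Q a -> Q b) ->
  open_arcs [set arc a | a in Q].
Proof.
move=> QS pS Qsm Qarc; split=> [_ [a Qa <-]|_ [a Qa <-]].
  by exists a => //; apply: Qsm.
pose U := [set arc a | a in Q].
exists r, [set jet r @` X | X in U]; split.
- split=> [_ [_ [b Qb <-] <-]|].
    by exists (arc b) => //; exists b => //; apply: Qsm.
  exists [set P | exists2 c, S c & forall a, c a = P.@[mxvec (jet r a) 0]].
  apply/seteqP; split=> J /=.
    move=> nJ P [c Sc cP]; apply/eqP/negPn/negP => PJ; apply: nJ.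
    have [b bJ] := jet_surj J; have Qb : Q b.
      by apply/QS; exists c => //; rewrite cP bJ.
    exists (jet r @` arc b); first by exists (arc b) => //; exists b.
    by exists b => //; apply: arc_refl.
  move=> EJ [_ [_ [b Qb <-] <-] [b' bb' b'J]].
  have /QS[c Sc] : Q b' by apply: Qarc Qb.
  have [P cP] := pS c Sc; rewrite cP b'J EJ ?eqxx //.
  by exists c.
- by exists (arc a) => //; exists a.
move=> _ [b smb <-] [_ [a' Qa' <-] e].
(* Equality of the truncated arcs provides a representative b' of the arc of a' with the same r-jet
   as b, and each c in S takes the same value on both. *)
have [b' a'b' jb'] : (jet r @` arc a') (jet r b).
  by rewrite e; exists b => //; apply: arc_refl.
exists b => //; have /QS[c Sc cb'] : Q b' by apply: Qarc Qa'.
by apply/QS; exists c => //; have [P cP] := pS c Sc; rewrite cP -jb' -cP.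
Qed.

End JetPolynomials.

(** * Smoothness and non-inflexionality under reparametrisation *)

Section Invariance.
Variables (F : fieldType) (n : nat).
Implicit Types (a b f : vseries F n).

(** The Plücker coordinates of the tangent line, that is of a_0 /\ a_1. *)
Definition minor a i j : F := a 0%N i 0 * a 1%N j 0 - a 0%N j 0 * a 1%N i 0.

Lemma arc_coef01 a b : arc a b -> exists w0 w1 u1, [/\ w0 != 0, u1 != 0 &
  forall i, b 0%N i 0 = w0 * a 0%N i 0 /\
            b 1%N i 0 = w0 * u1 * a 1%N i 0 + w1 * a 0%N i 0].
Proof.
move=> /arcP[w [u [w0 u0 u1 e]]]; exists (w 0%N), (w 1%N), (u 1%N); split=> // i.
have {}e : eqX 2 (tv 2 b i)
    (tr 2 w * ((a 0%N i 0)%:P + (a 1%N i 0)%:P * tr 2 u)).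
  apply: eqX_trans (e 2 i) _; apply: eqXM => //.
  have -> : (a 0%N i 0)%:P + (a 1%N i 0)%:P * tr 2 u =
            ((a 0%N i 0)%:P + (a 1%N i 0)%:P * 'X) \Po tr 2 u.
    by rewrite comp_polyD comp_polyM !comp_polyC comp_polyX.
  apply: eqX_comp; rewrite ?tr0 // => -[|[|//]] _.
    by rewrite coef_tv // coefD coefC coefMX addr0.
  by rewrite coef_tv // coefD coefC coefMX coefC add0r.
have := e 0%N isT; have := e 1%N isT.
rewrite !coef_tv // coefM !big_ord_recl big_ord0 coef0M !coefD !coefC !coefCM.
by rewrite !coef_tr //= u0 => -> ->; split; ring.
Qed.

Lemma minor_arc a b : arc a b -> exists2 x, x != 0 & forall i j, minor b i j = x * minor a i j.
Proof.
move=> /arc_coef01[w0 [w1 [u1 [w00 u10 e]]]].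
exists (w0 ^+ 2 * u1) => [|i j]; first by rewrite mulf_neq0 // expf_neq0.
have [i0 i1] := e i; have [j0 j1] := e j.
by rewrite /minor i0 i1 j0 j1; ring.
Qed.

Lemma smooth_arc a b : arc a b -> smooth_param a -> smooth_param b.
Proof.
move=> /minor_arc[x x0 e] [i [j m0]]; exists i, j.
by rewrite -/(minor b i j) e mulf_neq0.
Qed.

(** Reparametrisation multiplies (a_0, ..., a_n) on the right by the upper triangular matrix whose
    row l consists of the coefficients of w u^l, with diagonal entries w_0 u_1^l. *)
Lemma det_jetmx_arc a b : arc a b -> \det (jetmx a) != 0 -> \det (jetmx b) != 0.
Proof.
move=> /arcP[w [u [w0 u0 u1 /(_ n.+1) e]]] Wa.
have [v def_u] := coef0_Xfactor (tr0 n.+1 u0).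
pose T : 'M[F]_n.+1 := \matrix_(l, k) (tr n.+1 w * tr n.+1 u ^+ l)`_k.
have -> : jetmx b = jetmx a *m T.
  apply/matrixP => i k; rewrite !mxE -(@coef_tv _ _ n.+1) // e //.
  have -> : tv n.+1 a i = \sum_(l < n.+1) a l i 0 *: 'X^l by rewrite /tv /tr poly_def.
  rewrite raddf_sum mulr_sumr coef_sum; apply: eq_bigr => l _ /=.
  by rewrite !mxE linearZ /= comp_Xn_poly -scalerAr coefZ.
rewrite det_mulmx mulf_neq0 // -det_tr det_trig; last first.
  apply/is_trig_mxP => i j lt_ij; rewrite !mxE def_u exprMn mulrCA coefXnM.
  by rewrite lt_ij.
apply/prodf_neq0 => i _; rewrite !mxE def_u exprMn mulrCA coefXnM ltnn subnn.
rewrite coef0M coef0X coef_tr // mulf_neq0 //.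
have [->|n0] := posnP i; first by rewrite expr0 oner_neq0.
have n1 : (1 < n.+1)%N by have := ltn_ord i; lia.
by rewrite expf_neq0 //; move: u1; rewrite -(@coef_tr _ n.+1) // def_u coefXM.
Qed.

End Invariance.

(** * The locus where c_n is nonzero is open and non-empty *)

Section MongeOpen.
Variables (F : closedFieldType) (n : nat).
Hypothesis n2 : (2 <= n)%N.
Implicit Types (a b f : vseries F n).

Definition monge_generic : set (vseries F n) :=
  [set a | smooth_param a /\ (\det (jetmx a) != 0 /\ monge_poly a != 0)].

Lemma jetpoly_jetmx i j : jetpoly (n + 4) (fun a : vseries F n => jetmx a i j).
Proof.
have le_j : (j <= n + 4)%N by have := ltn_ord j; lia.
by apply: jetpoly_ext (jetpoly_coef F i le_j) => a; rewrite mxE.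
Qed.

Lemma jetpoly_cramer k i : (k <= 4)%N -> jetpoly (n + 4) (fun a : vseries F n => cramer a k i).
Proof.
move=> le_k4; apply: (@jetpoly_ext _ _ _ (fun a : vseries F n =>
   \sum_j (\adj (jetmx a)) (inord i) j * a (n + k)%N j 0)).
  by move=> a; rewrite /cramer mxE.
apply: jetpoly_sum => j; apply: jetpolyM; last by apply: jetpoly_coef; lia.
by apply: jetpoly_adj; apply: jetpoly_jetmx.
Qed.

Lemma jetpoly_monge : jetpoly (n + 4) (@monge_poly F n).
Proof.
have pW : jetpoly (n + 4) (fun a : vseries F n => \det (jetmx a)).
  by apply: jetpoly_det; apply: jetpoly_jetmx.
rewrite /monge_poly.
repeat first [exact: pW | exact: jetpoly_cst | (apply: jetpoly_cramer; lia)
  | apply: jetpolyX | apply: jetpolyD | apply: jetpolyM | apply: jetpolyN ].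
Qed.

Lemma generic_normal a : \det (jetmx a) != 0 -> monge_poly a != 0 ->
  exists g f, [/\ g \in unitmx, arc (gmul g a) f, normal f & kap f != 0].
Proof.
move=> W0 m0; have [g [f [gu gf nf e]]] := normal_form n2 W0.
exists g, f; split=> //; apply: contraNneq m0 => k0.
by rewrite -e -[f _ _ _]/(kap f) k0 mulr0.
Qed.

(** Nonvanishing passes through normal forms: those of a and b differ by some [tri x y z], and their
    invariants c_n by the nonzero factor (x/z)^3. *)
Lemma monge_generic_arc a b : arc a b -> monge_generic a -> monge_generic b.
Proof.
move=> ab [sma [Wa ma]]; have Wb := det_jetmx_arc ab Wa.
split; [exact: smooth_arc sma | split=> //].
have [g [f [gu gf nf k0]]] := generic_normal Wa ma.
have [h [f' [hu hf nf' e]]] := normal_form n2 Wb.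
rewrite -e -[f' _ _ _]/(kap f') mulf_neq0 ?expf_neq0 //.
have ff' : arc f' (gmul (h *m invmx g) f).
  apply: arc_trans (arc_sym hf) _; apply: (@arc_trans _ _ _ (gmul h a)).
    exact/gmul_arc/arc_sym.
  have -> : gmul h a = gmul (h *m invmx g) (gmul g a) by rewrite gmulA mulmxKV.
  exact: gmul_arc.
have [x [y [z [s [x0 z0 s0 def_g]]]]] := normal_unique (ltnW n2) nf nf' ff'.
rewrite def_g in ff'.
have {}ff' : arc f' (gmul (sympow n (tri x y z)) f).
  apply: arc_trans ff' _; apply: arc_sym; rewrite -(@arc_gmul_scale _ _ s) //.
  exact: arc_refl.
have [_ ek _] := transfer_invariants n2 x0 z0 nf (proj1 nf') ff'.
apply: contraNneq k0 => k0; move: ek; rewrite k0 mulr0 => /esym/eqP.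
by rewrite mulf_eq0 expf_eq0 (negPf x0).
Qed.

Lemma monge_generic_open : open_arcs [set arc a | a in monge_generic].
Proof.
apply: (@open_arcs_jetpoly _ _ (n + 4) [set c | exists i j,
    c = (fun a => minor a i j * (\det (jetmx a) * monge_poly a))]).
- move=> a; split=> [[[i [j m0]] [Wa ma]]|[_ [i [j ->]]]].
    by eexists; [exists i, j; reflexivity | rewrite !mulf_neq0].
  by rewrite !mulf_eq0 !negb_or => /and3P[m0 Wa ma]; split=> //; exists i, j.
- move=> _ [i [j ->]]; apply: jetpolyM.
    by apply: jetpolyB; apply: jetpolyM; apply: jetpoly_coef; lia.
  apply: jetpolyM; last exact: jetpoly_monge.
  by apply: jetpoly_det; apply: jetpoly_jetmx.
- by move=> a [].
- exact: monge_generic_arc.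
Qed.

Lemma monge_generic_nonempty : [set arc a | a in monge_generic] !=set0.
Proof.
(* The arc (1, t, ..., t^(n-1), t^n + t^(n+3)), already normal with c_n = 1. *)
pose a : vseries F n := fun k => \col_i ((k == i) || (k == n + 3)%N && (i == ord_max))%:R.
exists (arc a), a => //; split.
  have lt0 : (0 < n.+1)%N by [].
  have lt1 : (1 < n.+1)%N by lia.
  exists (Ordinal lt0), (Ordinal lt1); rewrite !mxE /=.
  rewrite (_ : (0 == n + 3)%N = false); last by lia.
  rewrite (_ : (1 == n + 3)%N = false); last by lia.
  by rewrite /= mulr1 mulr0 subr0 oner_neq0.
have ja : jetmx a = 1%:M.
  apply/matrixP => i j; rewrite !mxE eq_sym -val_eqE /=.
  rewrite (_ : (j == n + 3 :> nat)%N = false) ?orbF //.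
  by have := ltn_ord j; lia.
rewrite ja det1 oner_neq0; split=> //.
have cr k i : (i <= n)%N -> cramer a k i =
    ((n + k == i) || (n + k == n + 3) && (i == n))%N%:R.
  by move=> le_in; rewrite /cramer ja adj1 mul1mx mxE -val_eqE /= inordK.
rewrite /monge_poly ja det1 !cr; try lia.
rewrite !eqn_add2l eqxx /=.
rewrite (_ : (n + 2 == n)%N = false); last by lia.
rewrite (_ : (n + 1 == n)%N = false); last by lia.
rewrite (_ : (n + 2 == n - 1)%N = false); last by lia.
rewrite (_ : (n + 1 == n - 2)%N = false); last by lia.
rewrite (_ : (n + 1 == n - 1)%N = false); last by lia.
by rewrite /= !(mulr0, mul0r, expr0n, expr1n, subr0, addr0, mulr1) eqxx orbT mulr1 oner_neq0.
Qed.

End MongeOpen.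

(** * Equations of the slice on arbitrary representatives *)

Section SliceLocallyClosed.
Variables (F : fieldType) (n : nat).
Hypothesis n2 : (2 <= n)%N.
Implicit Types (a b f : vseries F n).

Let o0 : 'I_n.+1 := inord 0.
Let o1 : 'I_n.+1 := inord 1.

(** Nonzero exactly when x_1/x_0 is defined at the origin of the arc and has nonzero derivative
    there. *)
Definition frame a : F := a 0%N o0 0 * minor a o0 o1.

(* the slice is cut out by [f_i = slice_poly i] modulo [t^(slice_order i)] *)
Definition slice_order (i : nat) : nat :=
  if n == 2%N then 7%N else (if i <= n - 2 then n + 3 else n + 4)%N.

Definition slice_poly (i : nat) : {poly F} :=
  if i == n then 'X^n + 'X^(n + 3) else 'X^i.

(** The extreme case is n = 2, where 7 = n + 5; hence the truncations modulo t^(n+5) and the jets of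
    order n + 4 used below. *)
Lemma slice_order_le i : (slice_order i <= n + 5)%N.
Proof. by rewrite /slice_order; case: ifP => _; [|case: ifP => _]; lia. Qed.

Lemma slice_formE f : slice_form f <->
  affine f /\ forall i : 'I_n.+1, (2 <= i)%N ->
    eqX (slice_order i) (tv (n + 5) f i) (slice_poly i).
Proof.
have inn : inord n = ord_max :> 'I_n.+1 by apply: val_inj; rewrite /= inordK.
have in1 : (inord (n - 1) : 'I_n.+1) = (n - 1)%N :> nat by rewrite inordK //; lia.
have tvE (i : 'I_n.+1) k : (k < slice_order i)%N -> (tv (n + 5) f i)`_k = f k i 0.
  by move=> lt_k; rewrite coef_tv //; apply: leq_trans (slice_order_le i).
have lt_n (i : 'I_n.+1) : (i <= n)%N by rewrite -ltnS.
split=> [[f0 f1 fi]|[[f0 f1] fi]]; split=> //.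
  move=> i le2i k lt_k; rewrite tvE //; move: lt_k fi.
  rewrite /slice_order /slice_poly; case: (eqVneq n 2%N) => nn2 lt_k.
    have -> : i = ord_max by apply: val_inj => /=; have := lt_n i; lia.
    have inn2 : inord 2 = ord_max :> 'I_n.+1 by apply: val_inj; rewrite /= nn2 inordK.
    rewrite /coord inn2 eqxx => /(_ k lt_k) ->.
    by have -> : 'X^n + 'X^(n + 3) = 'X^2 + 'X^5 :> {poly F} by rewrite nn2.
  case=> fi fn1 fn; move: lt_k; case: (leqP i (n - 2)) => [le_i lt_k|lt_i lt_k].
    rewrite (ltn_eqF (_ : (i < n)%N)); last by lia.
    by rewrite -fi ?le2i // /coord inord_val.
  have [def_i|def_i] : i = (n - 1)%N :> nat \/ i = n :> nat by have := lt_n i; lia.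
    rewrite def_i (_ : (n - 1 == n)%N = false); last by lia.
    rewrite -fn1 // /coord; congr (f k _ 0); apply: val_inj.
    by rewrite /= in1.
  rewrite def_i eqxx -fn // /coord inn; congr (f k _ 0).
  exact: val_inj.
have fiE (i : nat) : (2 <= i <= n)%N ->
    eq_series_upto (slice_order i) (coord f i) (slice_poly i).
  move=> /andP[le2i le_in] k lt_k; have := fi (inord i).
  by rewrite inordK ?ltnS // => /(_ le2i k lt_k) <-; rewrite tvE // inordK.
move: fiE; rewrite /slice_order /slice_poly; case: (eqVneq n 2%N) => nn2 fiE.
  have := fiE 2%N; rewrite n2 (_ : (2 == n)%N); last by rewrite nn2.
  have -> : 'X^n + 'X^(n + 3) = 'X^2 + 'X^5 :> {poly F} by rewrite nn2.
  exact.
split=> [i le_i k lt_k||].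
- have := fiE i; rewrite (_ : (i <= n - 2)%N); last by case/andP: le_i.
  rewrite (ltn_eqF (_ : (i < n)%N)); last by lia.
  by apply=> //; lia.
- have := fiE (n - 1)%N; rewrite (_ : (n - 1 <= n - 2)%N = false); last by lia.
  rewrite (_ : (n - 1 == n)%N = false); last by lia.
  by apply; lia.
have := fiE n; rewrite (_ : (n <= n - 2)%N = false); last by lia.
by rewrite eqxx; apply; rewrite n2 /=.
Qed.

(* [b_i / b_0 = slice_poly i (b_1 / b_0)], denominators cleared *)
Definition slice_eqn (b : 'I_n.+1 -> {poly F}) (i : 'I_n.+1) : {poly F} :=
  b i * b o0 ^+ (n + 2) -
  (if val i == n then b o1 ^+ n * b o0 ^+ 3 + b o1 ^+ (n + 3)
   else b o1 ^+ i * b o0 ^+ (n + 3 - i)).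

Definition on_slice a := [/\ frame a != 0, a 0%N o1 0 = 0 &
  forall i : 'I_n.+1, (2 <= i)%N -> eqX (slice_order i) (slice_eqn (tv (n + 5) a) i) 0].

Lemma frame_arc a b : arc a b -> frame a != 0 -> frame b != 0.
Proof.
move=> ab; have [x x0 m] := minor_arc ab.
have [w0 [w1 [u1 [w00 u10 e]]]] := arc_coef01 ab.
have [e0 _] := e o0; rewrite /frame m e0 !mulf_eq0 !negb_or => /andP[-> ->].
by rewrite w00 x0.
Qed.

Lemma frame_smooth a : frame a != 0 -> smooth_param a.
Proof. by rewrite mulf_eq0 negb_or => /andP[_ m0]; exists o0, o1. Qed.

(** [slice_eqn] is homogeneous of degree n + 3 in the coordinates: a reparametrisation multiplies it
    by w^(n+3) and substitutes u, which preserves vanishing modulo a power of X. *)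
Lemma on_slice_arc a b : arc a b -> on_slice a -> on_slice b.
Proof.
move=> ab [fa a01 ea]; split; first exact: frame_arc fa.
  by have [w0 [w1 [u1 [_ _ e]]]] := arc_coef01 ab; have [-> _] := e o1; rewrite a01 mulr0.
have /arcP[w [u [w0 u0 u1 /(_ (n + 5)%N) e]]] := ab.
move=> i le2i; set m := slice_order i.
have le_in : (i <= n)%N by rewrite -ltnS.
pose W := tr (n + 5) w; pose U := tr (n + 5) u.
apply: (@eqX_trans _ _ (W ^+ (n + 3) * (slice_eqn (tv (n + 5) a) i \Po U))); last first.
  rewrite -[X in eqX _ _ X](mulr0 (W ^+ (n + 3))); apply: eqXM => //.
  rewrite -(comp_poly0 U); apply: eqX_comp => //; first exact: tr0.
  exact: ea.
apply: (@eqX_leq _ (n + 5)); first exact: slice_order_le.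
pose c i := tv (n + 5) a i \Po U.
have -> : W ^+ (n + 3) * (slice_eqn (tv (n + 5) a) i \Po U) =
    slice_eqn (fun i => W * c i) i.
  rewrite /slice_eqn comp_polyB; case: ifP => _.
    rewrite comp_polyD !comp_polyM !comp_poly_exp -!/(c _) !exprMn !exprD.
    by move: (c i) (c o0) (c o1) W => ci c0 c1 V; ring.
  rewrite !comp_polyM !comp_poly_exp -!/(c _) !exprMn mulrBr; congr (_ - _).
    rewrite !exprD; move: (c i) (c o0) (c o1) W => ci c0 c1 V; ring.
  have {1}-> : (n + 3 = i + (n + 3 - i))%N by lia.
  by rewrite exprD; move: (W ^+ _) (W ^+ _) (c o1 ^+ _) (c o0 ^+ _) => p q r s; ring.
rewrite /slice_eqn; apply: eqXB.
  by apply: eqXM; [exact: e | apply/eqXX/e].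
case: ifP => _; last by apply: eqXM; apply/eqXX/e.
by apply: eqXD; [apply: eqXM|]; apply/eqXX/e.
Qed.

Lemma on_slice_affine f : affine f -> on_slice f <-> slice_form f.
Proof.
move=> af; have a0 := @affine_tv0 _ _ (n + 5) _ af; have a1 := @affine_tv1 _ _ (n + 5) _ af.
have eqn i : eqX (n + 5) (slice_eqn (tv (n + 5) f) i) (tv (n + 5) f i - slice_poly i).
  rewrite /slice_eqn; apply: eqXB.
    by rewrite -[X in eqX _ _ X]mulr1 -(expr1n _ (n + 2)); apply: eqXM => //; apply: eqXX.
  rewrite /slice_poly; case: ifP => _.
    apply: eqXD; last exact: eqXX.
    by rewrite -[X in eqX _ _ X]mulr1 -(expr1n _ 3); apply: eqXM; apply: eqXX.
  by rewrite -[X in eqX _ _ X]mulr1 -(expr1n _ (n + 3 - i)); apply: eqXM; apply: eqXX.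
have eqn0 (i : 'I_n.+1) : eqX (slice_order i) (slice_eqn (tv (n + 5) f) i) 0 <->
    eqX (slice_order i) (tv (n + 5) f i) (slice_poly i).
  have en := eqX_leq (slice_order_le i) (eqn i).
  split=> e k lt_k; last by rewrite en // poly.coefB e // subrr coef0.
  by apply/eqP; rewrite -subr_eq0 -poly.coefB -en // e // coef0.
rewrite slice_formE; split=> [[_ _ ef]|[_ ef]].
  by split=> // i le2i; apply/eqn0/ef.
have [f0 f1] := af; split; last by move=> i le2i; apply/eqn0/ef.
  rewrite /frame /minor -[f 0%N o0 0]/(coord f 0 0%N) -[f 0%N o1 0]/(coord f 1 0%N).
  rewrite -[f 1%N o0 0]/(coord f 0 1%N) -[f 1%N o1 0]/(coord f 1 1%N).
  by rewrite !f0 !f1 !coefX !coef1 /= !(mulr1, mul1r, mulr0, subr0) oner_neq0.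
by rewrite -[f 0%N o1 0]/(coord f 1 0%N) f1 coefX.
Qed.

Lemma slice_mu3E : @slice_mu3 F n = [set arc a | a in on_slice].
Proof.
apply/seteqP; split=> _ [a sa <-].
  by exists a => //; apply/on_slice_affine => //; case: sa.
have [fa a01 _] := sa; move: fa; rewrite /frame /minor a01 mul0r subr0 !mulf_eq0.
rewrite !negb_or => /and3P[a00 _ a11].
have [f af aff] := affine_exists a00 a01 a11.
exists f; last by rewrite (arc_eq af).
by apply/on_slice_affine => //; apply: on_slice_arc sa.
Qed.

Lemma jetpoly_frame : jetpoly (n + 4) frame.
Proof.
apply: jetpolyM; first by apply: jetpoly_coef; lia.
by apply: jetpolyB; apply: jetpolyM; apply: jetpoly_coef; lia.
Qed.

Lemma frame_open : open_arcs [set arc a | a in [set a | frame a != 0]].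
Proof.
apply: (@open_arcs_jetpoly _ _ (n + 4) [set frame]).
- by move=> a; split=> [fa|[_ -> //]]; exists frame.
- by move=> _ ->; apply: jetpoly_frame.
- exact: frame_smooth.
- exact: frame_arc.
Qed.

Lemma off_slice_open :
  open_arcs [set arc a | a in [set a | frame a != 0 /\ ~ on_slice a]].
Proof.
pose eqns := [set c : vseries F n -> F | c = (fun a => a 0%N o1 0) \/
  exists i k, [/\ (2 <= val i)%N, (k < slice_order (val i))%N &
    c = (fun a => (slice_eqn (tv (n + 5) a) i)`_k)]].
apply: (@open_arcs_jetpoly _ _ (n + 4)
  [set c | exists2 d, eqns d & c = (fun a => frame a * d a)]).
- move=> a; split=> [[fa na]|[_ [d ed ->]]].
    apply: contrapT => nc; apply: na.
    have cz d : eqns d -> d a = 0.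
      move=> ed; apply/eqP/negPn/negP => da; apply: nc.
      by exists (fun a => frame a * d a); [exists d | rewrite mulf_neq0].
    split=> //; first by apply: (cz (fun a => a 0%N o1 0)); left.
    move=> i le2i k lt_k; rewrite coef0.
    by apply: (cz (fun a => (slice_eqn (tv (n + 5) a) i)`_k)); right; exists i, k.
  rewrite mulf_eq0 negb_or => /andP[fa /eqP da]; split=> // -[_ a01 ea]; apply: da.
  case: ed => [->//|[i [k [le2i lt_k ->]]]].
  by rewrite ea // coef0.
- move=> _ [d ed ->]; apply: jetpolyM; first exact: jetpoly_frame.
  case: ed => [->|[i [k [_ _ ->]]]]; first by apply: jetpoly_coef; lia.
  have tvP j : jetpolys (n + 4) (fun a : vseries F n => tv (n + 5) a j).
    by apply: jetpolys_tv; lia.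
  move: k; rewrite /slice_eqn; apply: jetpolysB.
    by apply: jetpolysM => //; apply: jetpolysX.
  case: (val i == n); last by apply: jetpolysM; apply: jetpolysX.
  by apply: jetpolysD; [apply: jetpolysM|]; apply: jetpolysX.
- by move=> a [fa _]; apply: frame_smooth.
move=> a b ab [fa na]; split; first exact: frame_arc fa.
by move=> nb; apply: na; apply: on_slice_arc (arc_sym ab) nb.
Qed.

Lemma slice_locally_closed : locally_closed_arcs (@slice_mu3 F n).
Proof.
pose V := [set arc a | a in [set a | frame a != 0 /\ ~ on_slice a]].
have smV : V `<=` @smooth_arcs F n.
  by move=> _ [a [fa _] <-]; exists a => //; apply: frame_smooth.
(* The closed set is the complement of the arcs with nonzero frame that lie off the slice; it may
   contain arcs with zero frame, which the open set removes. *)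
exists [set arc a | a in [set a | frame a != 0]], (@smooth_arcs F n `\` V); split.
- exact: frame_open.
- by move=> X [].
- rewrite setDD (_ : _ `&` V = V); first exact: off_slice_open.
  by apply/setIidr.
rewrite slice_mu3E; apply/seteqP; split=> [_ [a sa <-]|_ [[a fa <-] [_ na]]].
  have [fa _ _] := sa; split; first by exists a.
  split; first by exists a => //; apply: frame_smooth.
  move=> [b [_ nb] e]; apply: nb; apply: on_slice_arc sa.
  by rewrite -e; apply: arc_refl.
exists a => //; apply: contrapT => ns; apply: na.
by exists a.
Qed.

End SliceLocallyClosed.

(** * The group mu_3 *)

Section Mu3.
Variable R : realType.

Lemma expiD (x y : R) : expi (x + y) = expi x * expi y.
Proof.
apply/eqP; rewrite eq_complex /= cosD sinD eqxx /=.
by rewrite addrC.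
Qed.

Lemma expi0 : expi (0 : R) = 1.
Proof. by apply/eqP; rewrite eq_complex /= cos0 sin0 !eqxx. Qed.

Let zeta : R[i] := expi (pi / 3%:R).

Lemma expiN (x : R) : expi (- x) = (expi x)^-1.
Proof.
apply: (@mulfI _ (expi x)); last first.
  rewrite -expiD subrr expi0 mulfV //.
  by apply: contraTneq (oner_neq0 R[i]) => e; rewrite -expi0 -(subrr x) expiD e mul0r eqxx.
by apply: contraTneq (oner_neq0 R[i]) => e; rewrite -expi0 -(subrr x) expiD e mul0r eqxx.
Qed.

Lemma zeta3 : zeta ^+ 3 = -1.
Proof.
rewrite !exprS expr0 mulr1 -!expiD (_ : _ + _ = pi); last by field.
by apply/eqP; rewrite eq_complex /= cospi sinpi oppr0 !eqxx.
Qed.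

Lemma zeta_neq0 : zeta != 0.
Proof.
by have : zeta ^+ 3 != 0; [rewrite zeta3 oppr_eq0 oner_neq0 | rewrite expf_eq0].
Qed.

(** Otherwise zeta = zeta^3 = -1, whereas cos (pi/3) is positive. *)
Lemma zeta2 : zeta ^+ 2 != 1.
Proof.
apply/eqP => z2; have := zeta3; rewrite exprSr z2 mul1r => /eqP.
rewrite eq_complex => /andP[/eqP /= c _].
have : 0 < cos (pi / 3%:R : R).
  by apply: cos_gt0_pihalf; have := pi_gt0 R; lra.
by rewrite c; lra.
Qed.

Lemma mu3_gen_exp k : mu3_gen R ^+ k = tri (zeta ^+ k) 0 (zeta^-1 ^+ k).
Proof.
elim: k => [|k IH].
  apply/matrixP => i j; rewrite !mxE !expr0.
  by case: i => -[|[|//]] ?; case: j => -[|[|//]] ?.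
rewrite exprS IH; apply/matrixP => i j.
rewrite !mxE !big_ord_recl big_ord0 !mxE expiN -/zeta !exprS.
case: i => -[|[|//]] ?; case: j => -[|[|//]] ?; rewrite /= ?(mulr0n, mulr1n) /=.
- by rewrite mul0r !addr0.
- by rewrite !mul0r mulr0 !addr0.
- by rewrite mul0r mulr0 !addr0.
- by rewrite mulr0 add0r addr0.
Qed.

(** The generator multiplies the parameter by zeta^(-2). This is a primitive cube root of unity,
    since zeta^3 = -1 and zeta^2 is not 1, so its powers are all the cube roots of unity. *)
Lemma mu3E n : @mu3 R n = @cubic_group R[i] n.
Proof.
pose w : R[i] := zeta^-1 / zeta.
have z0 := zeta_neq0.
have w2 : w = (zeta ^+ 2)^-1 by rewrite /w expr2 invfM.
have w3 : w ^+ 3 = 1.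
  by rewrite w2 exprVn -exprM mulnC exprM zeta3 sqrrN expr1n invr1.
have w1 : w != 1 by rewrite w2 invr_eq1 zeta2.
have prim_w : 3.-primitive_root w.
  have [m prim_m] := prim_order_exists (isT : 0 < 3)%N w3.
  rewrite dvdn_divisors // => /=; rewrite !inE => /orP[]/eqP def_m; rewrite def_m // in prim_m *.
  by move: w1; rewrite -(prim_expr_order prim_m) expr1 eqxx.
have gE k : pgl (sympow n (mu3_gen R ^+ k)) = pgl (@dg R[i] n (w ^+ k)).
  have zk : zeta ^+ k != 0 by apply: expf_neq0.
  rewrite mu3_gen_exp (@sympow_diag _ n _ (zeta^-1 ^+ k) zk).
  rewrite pgl_scale; last exact: expf_neq0.
  by rewrite -expr_div_n.
apply/seteqP; split=> [_ [k _ <-]|_ [l l3 <-]].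
  by exists (w ^+ k); rewrite ?gE //= -exprM mulnC exprM w3 expr1n.
have [k ->] := prim_rootP prim_w l3.
by exists (val k) => //; rewrite gE.
Qed.

End Mu3.

Theorem theorem3 (R : realType) (n : nat) (n_ge2 : (2 <= n)%N) :
  (forall X : set (vseries R[i] n),
     (@noninflexional_arcs R[i] n `\` @monge_hypersurface R[i] n) X ->
     meets_along_orbit X (@slice_mu3 R[i] n) (@mu3 R n)) /\
  slice (@slice_mu3 R[i] n) (@mu3 R n).
Proof.
rewrite mu3E; split=> [_ [[a [sma Wa] <-] notM]|].
  have [g [f [gu gf nf _]]] := normal_form n_ge2 Wa.
  apply: (meets_cubic_group n_ge2 gu gf nf).
  apply/eqP => k0; apply: notM; apply: (normal_monge n_ge2 _ gu gf nf k0).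
  by exists a.
split.
- exact: slice_locally_closed.
- exact: cubic_group_subgroup.
- by move=> K X; apply: cubic_group_stable.
exists [set arc a | a in @monge_generic R[i] n]; split.
- exact: monge_generic_open.
- exact: monge_generic_nonempty.
move=> _ [a [_ [Wa ma]] <-].
have [g [f [gu gf nf k0]]] := generic_normal n_ge2 Wa ma.
exact: (meets_cubic_group n_ge2 gu gf nf k0).
Qed.
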